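(* Suppose that $K$ is a closed subset of $\mathbb{H}\cong\mathbb{R}^4$ and let $S=\{s_{(m,n)}\}_{(m,n)\in\mathsf{N}}$ be a quaternionic sequence. Then the following are equivalent: (i) $S$ is a $K$-moment sequence. (ii) $L_S$ is a $K$-moment functional on $\mathbb{H}^0[q^*,q]$. (iii) $L_S(f)\ge 0$ for all polynomials $f:=f_0+x_1f_1+x_2f_2+x_3f_3$, where $f_0,f_1,f_2,f_3\in\mathbb{R}[x_0,x_1^2+x_2^2+x_3^2]$, such that $f(x)\ge 0$ for all $x\in K$.
   Context: $\mathbb{H}$ is the algebra of quaternions $q=x_0+x_1\mathrm{i}+x_2\mathrm{j}+x_3\mathrm{k}$, identified with $(x_0,x_1,x_2,x_3)\in\mathbb{R}^4$, with conjugation $q^*=x_0-x_1\mathrm{i}-x_2\mathrm{j}-x_3\mathrm{k}$. Polynomials are regarded as continuous $\mathbb{H}$-valued functions on $\mathbb{H}$. $\mathbb{H}^0[q^*,q]$ is the set of finite sums of terms $a(q^* )^kq^lb$ with $a,b\in\mathbb{H}$, $k,l\in\mathbb{N}_0$. Real polynomials of the form $f_0+x_1f_1+x_2f_2+x_3f_3$ with $f_i\in\mathbb{R}[x_0,x_1^2+x_2^2+x_3^2]$ (the real algebra generated by $x_0$ and $x_1^2+x_2^2+x_3^2$) belong to $\mathbb{H}^0[q^*,q]$. Let $\Sigma=\{1,\mathrm{i},\mathrm{j},\mathrm{k}\}$, $\mathcal{N}=\{(k,n,\sigma): k,n\in\mathbb{N}_0, n>k,\sigma\in\Sigma\}\cup\{(n,n,1):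 n\in\mathbb{N}_0\}$, and $\mathsf{N}=\{(m,n): m,n\in\mathbb{N}_0, n\ge m\}$. Each $f\in\mathbb{H}^0[q^*,q]$ is uniquely a finite sum $f=\sum_{(m,n,\sigma)\in\mathcal{N}}a_{(m,n,\sigma)}(q^* )^mq^n\sigma$ with $a_{(m,n,\sigma)}\in\mathbb{H}$. A quaternionic sequence is a family $S=\{s_{(m,n)}\}_{(m,n)\in\mathsf{N}}$ with $s_{(m,n)}\in\mathbb{H}$; its Riesz functional is $L_S:\mathbb{H}^0[q^*,q]\to\mathbb{H}$, $L_S(f):=\sum_{(m,n,\sigma)\in\mathcal{N}}a_{(m,n,\sigma)}s_{(m,n)}\sigma$. $S$ is a $K$-moment sequence if there is a (positive) Radon measure $\mu$ on $\mathbb{H}$ with $\mathrm{supp}\,\mu\subseteq K$ and $s_{(m,n)}=\int_{\mathbb{H}}(q^* )^mq^n\,d\mu(q)$ for all $(m,n)\in\mathsf{N}$. A functional $L$ on $\mathbb{H}^0[q^*,q]$ is called an $\mathbb{H}$-linear functional if $L(afb+cgd)=aL(f)b+cL(g)d$ for all $f,g$ and $a,b,c,d\in\mathbb{H}$; it is a $K$-moment functional if it is $\mathbb{H}$-linear and there is a (positive) Radon measure $\mu$ on $K$ with $L(f)=\int_Kf\,d\mu$ for all $f\in\mathbb{H}^0[q^*,q]$. Integral formulas include integrability. For a quaternion $p$, ''$p\ge0$'' means that $p$ is real and nonnegative. *)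

(* Defs.v *)
From HB Require Import structures.
From mathcomp Require Import all_boot all_order all_algebra.
From mathcomp Require Import all_classical all_reals all_analysis.
From mathcomp Require Import ring.

Set Implicit Arguments.
Unset Strict Implicit.
Unset Printing Implicit Defensive.

Import Order.TTheory GRing.Theory Num.Theory.
Import numFieldNormedType.Exports.

Local Open Scope classical_set_scope.
Local Open Scope ring_scope.

(* The quaternions [x0 + x1 i + x2 j + x3 k], with the additive group and the
   topology of R^4. *)
Definition quat (R : realType) := 'rV[R]_4.

HB.instance Definition _ (R : realType) := GRing.Zmodule.copy (quat R) 'rV[R]_4.
HB.instance Definition _ (R : realType) := Topological.copy (quat R) 'rV[R]_4.
HB.instance Definition _ (R : realType) := Pointed.copy (quat R) 'rV[R]_4.

Section Quaternions.
Variable R : realType.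
Implicit Types p q : quat R.

Definition mkquat (a b c d : R) : quat R :=
  \row_(i < 4) nth 0 [:: a; b; c; d] i.

Definition x0 q : R := q ord0 (inord 0).
Definition x1 q : R := q ord0 (inord 1).
Definition x2 q : R := q ord0 (inord 2).
Definition x3 q : R := q ord0 (inord 3).

Definition qone : quat R := mkquat 1 0 0 0.
Definition qi : quat R := mkquat 0 1 0 0.
Definition qj : quat R := mkquat 0 0 1 0.
Definition qk : quat R := mkquat 0 0 0 1.

Definition qreal (r : R) : quat R := mkquat r 0 0 0.

Definition qconj q : quat R := mkquat (x0 q) (- x1 q) (- x2 q) (- x3 q).

Definition qmul p q : quat R := mkquat
  (x0 p * x0 q - x1 p * x1 q - x2 p * x2 q - x3 p * x3 q)
  (x0 p * x1 q + x1 p * x0 q + x2 p * x3 q - x3 p * x2 q)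
  (x0 p * x2 q - x1 p * x3 q + x2 p * x0 q + x3 p * x1 q)
  (x0 p * x3 q + x1 p * x2 q - x2 p * x1 q + x3 p * x0 q).

Lemma mkquatE (a b c d : R) :
  (x0 (mkquat a b c d) = a) * (x1 (mkquat a b c d) = b) *
  (x2 (mkquat a b c d) = c) * (x3 (mkquat a b c d) = d).
Proof. by rewrite /x0 /x1 /x2 /x3 !mxE !inordK. Qed.

Lemma quatP p q : x0 p = x0 q -> x1 p = x1 q -> x2 p = x2 q -> x3 p = x3 q ->
  p = q.
Proof.
move=> h0 h1 h2 h3; apply/rowP => i; rewrite -(inord_val i).
by case: i => -[|[|[|[|]]]].
Qed.

Lemma quatD p q : (x0 (p + q) = x0 p + x0 q) * (x1 (p + q) = x1 p + x1 q) *
  (x2 (p + q) = x2 p + x2 q) * (x3 (p + q) = x3 p + x3 q).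
Proof. by rewrite /x0 /x1 /x2 /x3 !mxE. Qed.

Let quatE := (mkquatE, quatD).

Lemma qmulA : associative qmul.
Proof. by move=> p q r; apply: quatP; rewrite /qmul !quatE; ring. Qed.

Lemma qmul1q : left_id qone qmul.
Proof. by move=> p; apply: quatP; rewrite /qmul !quatE; ring. Qed.

Lemma qmulq1 : right_id qone qmul.
Proof. by move=> p; apply: quatP; rewrite /qmul !quatE; ring. Qed.

Lemma qmulDl : left_distributive qmul +%R.
Proof. by move=> p q r; apply: quatP; rewrite /qmul !quatE; ring. Qed.

Lemma qmulDr : right_distributive qmul +%R.
Proof. by move=> p q r; apply: quatP; rewrite /qmul !quatE; ring. Qed.

Lemma qone_neq0 : qone != 0.
Proof.
apply/eqP => /(congr1 x0); rewrite mkquatE /x0 mxE => /eqP.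
by rewrite oner_eq0.
Qed.

HB.instance Definition _ := GRing.Zmodule_isNzRing.Build (quat R)
  qmulA qmul1q qmulq1 qmulDl qmulDr qone_neq0.

Definition qnonneg p : Prop := exists2 r : R, 0 <= r & p = qreal r.

Definition qmonom (m n : nat) (q : quat R) : quat R := qconj q ^+ m * q ^+ n.

(* H^0[q^*, q] *)
Definition qpoly : set (quat R -> quat R) :=
  [set f | exists s : seq (quat R * nat * nat * quat R),
    f = fun q => \sum_(t <- s) t.1.1.1 * qmonom t.1.1.2 t.1.2 q * t.2].

(* R[x0, x1^2 + x2^2 + x3^2]: the outer variable of [p] is evaluated at x0, the
   inner one at x1^2 + x2^2 + x3^2. *)
Definition realpoly : set (quat R -> R) :=
  [set f | exists p : {poly {poly R}},
    f = fun q => p.[(x0 q)%:P].[x1 q ^+ 2 + x2 q ^+ 2 + x3 q ^+ 2]].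

Definition qunits : set (quat R) := [set 1; qi; qj; qk].

(* [(m, n, sigma)] indexes the monomial [(q^* )^m q^n sigma]. *)
Definition qindex : set (nat * nat * quat R) :=
  [set t | (t.1.1 < t.1.2)%N /\ qunits t.2] `|`
  [set t | t.1.1 = t.1.2 /\ t.2 = 1].

Definition qexpansion (f : quat R -> quat R) : set (nat * nat * quat R -> quat R) :=
  [set a | [/\ finite_set [set t | a t != 0],
               [set t | a t != 0] `<=` qindex &
    f = fun q => \sum_(t \in qindex) a t * qmonom t.1.1 t.1.2 q * t.2]].

(* Every element of [qpoly] has exactly one expansion, so the value of
   [qcoeff] does not depend on the choice operator there; outside of [qpoly]
   it is irrelevant. *)
Definition qcoeff (f : quat R -> quat R) : nat * nat * quat R -> quat R :=
  xget (fun=> 0) (qexpansion f).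

(* A quaternionic sequence is represented by [S : nat -> nat -> quat R], of
   which only the values [S m n] with [m <= n] are ever used. *)
Definition riesz (S : nat -> nat -> quat R) (f : quat R -> quat R) : quat R :=
  \sum_(t \in qindex) qcoeff f t * S t.1.1 t.1.2 * t.2.

Definition borel_quat := g_sigma_algebraType (@open (quat R)).

Definition radon (mu : {measure set borel_quat -> \bar R}) : Prop :=
  (forall C : set (quat R), compact C -> (mu C < +oo)%E) /\
  (forall A : set borel_quat, measurable A ->
    mu A = ereal_sup [set mu C | C in [set C : set (quat R) | compact C /\ C `<=` A]]).

Definition measure_support (mu : {measure set borel_quat -> \bar R}) :
    set (quat R) :=
  [set q | forall U : set (quat R), open U -> U q -> (0 < mu U)%E].

Definition qintegrable (mu : {measure set borel_quat -> \bar R})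
    (D : set borel_quat) (f : quat R -> quat R) : Prop :=
  [/\ mu.-integrable D (fun q => (x0 (f q))%:E),
      mu.-integrable D (fun q => (x1 (f q))%:E),
      mu.-integrable D (fun q => (x2 (f q))%:E) &
      mu.-integrable D (fun q => (x3 (f q))%:E)].

Definition qintegral (mu : {measure set borel_quat -> \bar R})
    (D : set borel_quat) (f : quat R -> quat R) : quat R :=
  mkquat (Rintegral mu D (fun q => x0 (f q))) (Rintegral mu D (fun q => x1 (f q)))
         (Rintegral mu D (fun q => x2 (f q))) (Rintegral mu D (fun q => x3 (f q))).

Definition moment_sequence (K : set (quat R)) (S : nat -> nat -> quat R) : Prop :=
  exists mu : {measure set borel_quat -> \bar R},
    [/\ radon mu, measure_support mu `<=` K &
        forall m n, (m <= n)%N ->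
          qintegrable mu setT (qmonom m n) /\
          S m n = qintegral mu setT (qmonom m n)].

Definition qlinear (L : (quat R -> quat R) -> quat R) : Prop :=
  forall f g, qpoly f -> qpoly g -> forall a b c d : quat R,
    L (fun q => a * f q * b + c * g q * d) = a * L f * b + c * L g * d.

(* A Radon measure on the closed set [K] is represented by its extension by
   zero to H; [measurableType]s being pointed, measures on the subspace [K]
   itself are not available when [K] is empty. *)
Definition moment_functional (K : set (quat R))
    (L : (quat R -> quat R) -> quat R) : Prop :=
  qlinear L /\
  exists mu : {measure set borel_quat -> \bar R},
    [/\ radon mu, mu (~` K) = 0%E &
        forall f, qpoly f -> qintegrable mu K f /\ L f = qintegral mu K f].

End Quaternions.

(* Main.v *)
Require Import Defs.
From HB Require Import structures.
From mathcomp Require Import all_boot all_order all_algebra.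
From mathcomp Require Import all_classical all_reals all_analysis.
From mathcomp Require Import measurable_realfun ring lra.
(* [Defs.qpoly] is otherwise hidden by the [qpoly] of mathcomp. *)
Import Defs.

(* The real polynomials [f0 + x1 f1 + x2 f2 + x3 f3] form an adapted space [E]
   (each of them is [o(g)] for some [g] in [E]) which contains the components of
   all the monomials [(q^* )^m q^n], so (iii) implies (i) by Haviland's theorem
   for [E].

   Haviland's theorem is obtained without a Riesz representation theorem. As in
   M. Riesz' extension argument, the functional [L] is extended to the
   indicators of the cells of a binary tree, whose [k]-th digit at [x] says
   whether a given coordinate of [x] is at least a given rational. Splitting
   [0, L 1[ into intervals of the same lengths as the weights of the cells
   attaches to almost every [t] a nested sequence of cells that shrinks to a
   point [X t] of [K]; the representing measure is the image of Lebesgue measure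
   by [X]. Fatou's lemma gives [\int f \o X <= L f] for [f >= 0] on [K], and this
   inequality for [e g + C - f] is the converse one up to [e].

   The Riesz functional [L_S] is well defined because the expansion in the
   monomials [(q^* )^m q^n sigma] is unique: in the variables [x = Re q] and
   [t = |q|^2] the real and imaginary parts of [q^n] are triangular with respect
   to the powers of [x]. *)

Set Implicit Arguments.
Unset Strict Implicit.
Unset Printing Implicit Defensive.

Import Order.TTheory GRing.Theory Num.Theory.
Import numFieldNormedType.Exports.

Local Open Scope classical_set_scope.
Local Open Scope ring_scope.

(** * Positive functionals and adapted spaces *)

(** The polynomials in (iii) do not form an algebra, since x1 x2 is not one of them, so majorants
    cannot simply be squares of elements; they are found among the polynomials in x0 and x1^2 + x2^2
    + x3^2. Two things can go wrong between digit sequences and points. A coordinate may escape to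
    infinity, which has measure zero by Chebyshev's inequality because |x|^2 belongs to the space;
    and half-open cells need not contain the limit of their points, which is where closedness of K
    enters. Since X is continuous on the complement of a null set, inner regularity of Lebesgue
    measure carries over to the image, so the measure comes out as a Radon measure. L_S is additive
    and left H-linear, but for a general sequence not right H-linear. Hence the passage from (iii)
    to (i) uses left multiples only, and the two-sided linearity in (ii) is read off from the
    integral. *)

Section PositiveExtension.
Variables (R : realType) (T : Type) (K : set T) (E : set (T -> R)).
Variables (L : (T -> R) -> R) (h : nat -> T -> R).
Hypothesis ED : forall f g, E f -> E g -> E (fun x => f x + g x).
Hypothesis EZ : forall a f, E f -> E (fun x => a * f x).
Hypothesis LD : forall f g, E f -> E g -> L (fun x => f x + g x) = L f + L g.
Hypothesis LZ : forall a f, E f -> L (fun x => a * f x) = a * L f.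
Hypothesis Lge0 : forall f, E f -> (forall x, K x -> 0 <= f x) -> 0 <= L f.
Hypothesis dom_h : forall k, exists2 g, E g & forall x, K x -> `|h k x| <= g x.

Let comb (u : nat -> R) (s : seq (R * nat)) : R := \sum_(p <- s) p.1 * u p.2.

(** Positivity on E plus the span of the first n functions, stated for representations so that these
    functions may be dependent: two representations of one function get equal values, because their
    difference and its opposite are both nonnegative. *)
Let positive (c : nat -> R) n := forall g s, E g ->
  all (fun p => (p.2 < n)%N) s ->
  (forall x, K x -> 0 <= g x + comb (h ^~ x) s) -> 0 <= L g + comb c s.

Let scale a (s : seq (R * nat)) := [seq (a * p.1, p.2) | p <- s].

Let comb_scale u a s : comb u (scale a s) = a * comb u s.
Proof.
by rewrite /comb big_map mulr_sumr; apply: eq_bigr => p _; rewrite mulrA.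
Qed.

Let comb_cat u s t : comb u (s ++ t) = comb u s + comb u t.
Proof. exact: big_cat. Qed.

Let all_scale a n s :
  all (fun p => (p.2 < n)%N) (scale a s) = all (fun p => (p.2 < n)%N) s.
Proof. by rewrite all_map. Qed.

Let comb_ext u v n s : (forall k, (k < n)%N -> u k = v k) ->
  all (fun p => (p.2 < n)%N) s -> comb u s = comb v s.
Proof.
move=> uv /allP sn; apply: eq_big_seq => p /sn /= pn; by rewrite uv.
Qed.

Let comb_last n s : all (fun p => (p.2 < n.+1)%N) s -> exists a s',
  all (fun p => (p.2 < n)%N) s' /\ forall u, comb u s = a * u n + comb u s'.
Proof.
elim: s => [|[b k] s IH] /=.
  by exists 0, [::]; split=> // v; rewrite /comb big_nil; ring.
move=> /andP[kn /IH[a [s' [sn' ss']]]].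
move: kn; rewrite ltnS leq_eqVlt => /orP[/eqP ->|kn].
  exists (a + b), s'; split => // v.
  by rewrite /comb big_cons /= -/(comb v s) -/(comb v s') ss'; ring.
exists a, ((b, k) :: s'); split => [|v]; first by rewrite /= kn.
by rewrite /comb !big_cons /= -/(comb v s) -/(comb v s') ss'; ring.
Qed.

(* M. Riesz: the new value is the infimum of the upper bounds it must obey. *)
Let positive_step c n : positive c n ->
  exists v, positive (fun k => if k == n then v else c k) n.+1.
Proof.
move=> pc; have [g0 Eg0 hg0] := dom_h n.
pose U := [set L p.1 + comb c p.2 | p in [set p : (T -> R) * seq (R * nat) |
  [/\ E p.1, all (fun q => (q.2 < n)%N) p.2 &
   forall x, K x -> h n x <= p.1 x + comb (h ^~ x) p.2]]].
have comb0 u : comb u [::] = 0 by exact: big_nil.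
(* A majorant minus a minorant of [h n] is nonnegative on K and does not involve [h n], so
   positivity at stage n compares their values. *)
have lbU g s : E g -> all (fun p => (p.2 < n)%N) s ->
    (forall x, K x -> g x + comb (h ^~ x) s <= h n x) ->
    lbound U (L g + comb c s).
  move=> Eg sn gs _ [[g' s'] /= [Eg' sn' gs'] <-].
  rewrite -subr_ge0.
  have -> : L g' + comb c s' - (L g + comb c s) =
            L (fun x => g' x + -1 * g x) + comb c (s' ++ scale (-1) s).
    by rewrite LD ?LZ//; [rewrite comb_cat comb_scale; ring | exact: EZ].
  apply: pc; [exact: ED (EZ _ _) | by rewrite all_cat all_scale sn sn' | ].
  move=> x Kx; rewrite comb_cat comb_scale.
  by have := gs x Kx; have := gs' x Kx; lra.
have hU : has_inf U.
  split.
    exists (L g0 + comb c [::]), (g0, [::]) => //=; split => // x Kx.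
    by rewrite comb0 addr0; exact: le_trans (ler_norm _) (hg0 x Kx).
  exists (L (fun x => -1 * g0 x) + comb c [::]).
  apply: lbU => // [|x Kx]; first exact: EZ.
  rewrite comb0 addr0 mulN1r.
  by have := hg0 x Kx; rewrite ler_norml => /andP[].
exists (inf U) => g s Eg sn gs.
have [a [s' [sn' ss']]] := comb_last sn.
rewrite ss' eqxx (_ : comb _ s' = comb c s'); last first.
  by apply: comb_ext sn' => k kn; rewrite ltn_eqF.
have {}gs x : K x -> 0 <= g x + (a * h n x + comb (h ^~ x) s').
  by move=> Kx; rewrite -ss'; exact: gs.
(* Division by |a| turns the rest of the combination into a majorant of [h n] if a < 0, and its
   opposite into a minorant if a > 0. *)
have [a0|a0|a0] := ltgtP a 0.
- have ai : 0 < (- a)^-1 by rewrite invr_gt0 oppr_gt0.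
  have : inf U <= L (fun x => (- a)^-1 * g x) + comb c (scale (- a)^-1 s').
    apply: ge_inf; first exact: hU.2.
    exists ((fun x => (- a)^-1 * g x), scale (- a)^-1 s') => //=.
    split; [exact: EZ | by rewrite all_scale | ] => x Kx.
    rewrite comb_scale -mulrDr mulrC ler_pdivlMr ?oppr_gt0//.
    by have := gs x Kx; lra.
  rewrite LZ// comb_scale -mulrDr mulrC ler_pdivlMr ?oppr_gt0//; lra.
- have ai : 0 < a^-1 by rewrite invr_gt0.
  have : L (fun x => - a^-1 * g x) + comb c (scale (- a^-1) s') <= inf U.
    apply: lb_le_inf; first exact: hU.1.
    apply: lbU; [exact: EZ | by rewrite all_scale | ] => x Kx.
    rewrite comb_scale -mulrDr mulNr lerNl mulrC ler_pdivlMr//.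
    by have := gs x Kx; lra.
  rewrite LZ// comb_scale -mulrDr mulNr lerNl mulrC ler_pdivlMr//; lra.
- rewrite a0 mul0r add0r; apply: pc => // x Kx.
  by have := gs x Kx; rewrite a0 mul0r add0r.
Qed.

Lemma positive_extension : exists c : nat -> R, forall g s, E g ->
  (forall x, K x -> 0 <= g x + \sum_(p <- s) p.1 * h p.2 x) ->
  0 <= L g + \sum_(p <- s) p.1 * c p.2.
Proof.
have p0 : positive (fun=> 0) 0.
  move=> g [|//] Eg _ gs; rewrite /comb big_nil addr0; apply: Lge0 => // x Kx.
  by have := gs x Kx; rewrite /comb big_nil addr0.
have /choice[nxt nxtP] : forall p : (nat -> R) * nat, exists v,
    positive p.1 p.2 -> positive (fun k => if k == p.2 then v else p.1 k) p.2.+1.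
  move=> [c n] /=; have [pc|npc] := pselect (positive c n).
    by have [v pv] := positive_step pc; exists v.
  by exists 0.
pose fix cs n : nat -> R := if n is m.+1 then
  fun k => if k == m then nxt (cs m, m) else cs m k else fun=> 0.
have pcs n : positive (cs n) n.
  by elim: n => [|n IH] //=; exact: (nxtP (cs n, n)).
(* Stage m + 1 changes only the value at m, so the diagonal agrees with every later stage; a given
   list involves only finitely many indices. *)
have csE n k : (k < n)%N -> cs n k = cs k.+1 k.
  elim: n => // n IH; rewrite ltnS leq_eqVlt => /orP[/eqP -> //|kn].
  by rewrite /= ltn_eqF// IH.
exists (fun k => cs k.+1 k) => g s Eg gs.
pose n := (\max_(p <- s) p.2).+1.
have sn : all (fun p => (p.2 < n)%N) s.
  by apply/allP => p ps; rewrite ltnS; by rewrite (leq_bigmax_seq (F := snd) p).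
have := pcs n g s Eg sn gs.
by rewrite (comb_ext (v := fun k => cs k.+1 k) (n := n))// => k /csE.
Qed.

End PositiveExtension.

(** * Weighted binary trees and Lebesgue measure on an interval *)

Section BinaryTree.
Variables (R : realType) (c : seq bool -> R).
Hypothesis c_ge0 : forall w, 0 <= c w.
Hypothesis c_split : forall w, c w = c (rcons w false) + c (rcons w true).

(* The words of a given length index consecutive intervals of [0, c [::][, that
   of [w] being [tree_left w, tree_left w + c w[; [tree_path t n] is the word of
   length [n] whose interval contains [t]. *)
Definition tree_left (w : seq bool) : R :=
  \sum_(k < size w) (if nth false w k then c (rcons (take k w) false) else 0).

Fixpoint tree_path (t : R) (n : nat) : seq bool :=
  if n is m.+1 then
    let w := tree_path t m in rcons w (tree_left w + c (rcons w false) <= t)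
  else [::].

Definition tree_digit t k := nth false (tree_path t k.+1) k.

Lemma tree_left_rcons w b : tree_left (rcons w b) =
  tree_left w + (if b then c (rcons w false) else 0).
Proof.
rewrite /tree_left size_rcons big_ord_recr /= nth_rcons ltnn eqxx.
rewrite -cats1 take_size_cat//; congr (_ + _); apply: eq_bigr => i _.
by rewrite nth_cat ltn_ord takel_cat// ltnW.
Qed.

Lemma size_tree_path t n : size (tree_path t n) = n.
Proof. by elim: n => //= n IH; rewrite size_rcons IH. Qed.

Lemma take_tree_path t m n : (m <= n)%N ->
  take m (tree_path t n) = tree_path t m.
Proof.
elim: n => [|n IH]; first by rewrite leqn0 => /eqP ->.
rewrite leq_eqVlt => /orP[/eqP ->|mn].
  by rewrite take_oversize// size_tree_path.
by rewrite /= -cats1 takel_cat ?IH// size_tree_path.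
Qed.

Lemma nth_tree_path t n k : (k < n)%N ->
  nth false (tree_path t n) k = tree_digit t k.
Proof.
by move=> kn; rewrite /tree_digit -(take_tree_path t kn) nth_take.
Qed.

(** By [c_split] the intervals of the two children partition that of their parent, [false] on the
    left; the path makes the same choice digit by digit. *)
Lemma tree_path_cell t w : 0 <= t < c [::] ->
  (tree_path t (size w) == w) = (tree_left w <= t < tree_left w + c w).
Proof.
move=> tM; elim/last_ind: w => [|w b IH].
  by rewrite /= /tree_left big_ord0 add0r tM.
rewrite size_rcons /= eqseq_rcons; have [pw|pw] := eqVneq (tree_path t _) w.
  rewrite pw eqxx in IH *; rewrite tree_left_rcons /=.
  have /esym/andP[lt tr] := IH; have := c_split w.
  case: b; case: (leP (tree_left w + c (rcons w false)) t) => h cw.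
  - by apply/esym/andP; split; lra.
  - by [].
  - by apply/esym/negbTE; rewrite negb_and addr0 -!leNgt h orbT.
  - by apply/esym/andP; split; lra.
apply/esym/negbTE/negP; rewrite tree_left_rcons => /andP[h1 h2].
move/negbTE: pw IH => -> /esym /negP; apply.
have := c_split w; have := c_ge0 (rcons w false); have := c_ge0 (rcons w true).
by case: b h1 h2 => h1 h2 *; apply/andP; split; lra.
Qed.

Lemma measurable_tree_cell n w :
  measurable [set t : measurableTypeR R | tree_path t n = w].
Proof.
elim: n w => [|n IH] w.
  have [->|w0] := eqVneq w [::].
    by rewrite (_ : [set _ | _] = setT)//; apply/seteqP; split.
  rewrite (_ : [set _ | _] = set0)//; apply/seteqP; split => // t /= h.
  by rewrite -h eqxx in w0.
case/lastP: w => [|w b].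
  rewrite (_ : [set _ | _] = set0)//; apply/seteqP; split => // t /=.
  by move/(congr1 size); rewrite size_rcons.
pose a := tree_left w + c (rcons w false).
rewrite (_ : [set _ | _] = [set t | tree_path t n = w] `&`
    [set` (if b then `[a, +oo[ else `]-oo, a[)]).
  by apply: measurableI => //; case: b; exact: measurable_itv.
apply/seteqP; split => t /= => [/rcons_inj[pw <-]|[pw]].
  split => //; rewrite pw -/a.
  by case: (leP a t) => h; rewrite /= in_itv /= ?andbT.
rewrite pw -/a => h; congr rcons; case: b h; rewrite in_itv /= ?andbT//.
by rewrite leNgt => ->.
Qed.

(** Words are countable, so an arbitrary predicate on them gives a countable union of cells. *)
Lemma measurable_tree_pred n (P : seq bool -> Prop) :
  measurable [set t : measurableTypeR R | P (tree_path t n)].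
Proof.
rewrite (_ : [set t | P _] = \bigcup_(k in
    [set k | exists2 w, unpickle k = Some w & P w])
      [set t | Some (tree_path t n) = unpickle k]).
  apply: bigcup_measurable => k [w -> _].
  rewrite (_ : [set _ | _] = [set t | tree_path t n = w]).
    exact: measurable_tree_cell.
  by apply/seteqP; split => t; [case | move=> /= ->].
apply/seteqP; split => [t Pt|t [k [w kw Pw] tk]].
  exists (pickle (tree_path t n)); last by rewrite /mkset pickleK.
  by exists (tree_path t n); rewrite ?pickleK.
by move: tk; rewrite /mkset kw => -[->].
Qed.

Definition tree_measure : set (measurableTypeR R) -> \bar R :=
  mrestr lebesgue_measure (measurable_itv `[0, c [::][).

HB.instance Definition _ := Measure.on tree_measure.

Lemma tree_measure_setT : tree_measure setT = (c [::])%:E.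
Proof.
rewrite /tree_measure /mrestr setTI lebesgue_measure_itv /= lte_fin.
have := c_ge0 [::]; rewrite le_eqVlt => /orP[/eqP <-|->]; first by rewrite ltxx.
by rewrite sube0.
Qed.

Lemma tree_measure_cell w :
  tree_measure [set t | tree_path t (size w) = w] = (c w)%:E.
Proof.
rewrite /tree_measure /mrestr.
rewrite (_ : _ `&` _ = `[tree_left w, tree_left w + c w[%classic).
  rewrite lebesgue_measure_itv /= lte_fin ltrDl.
  have := c_ge0 w; rewrite le_eqVlt => /orP[/eqP <-|h]; first by rewrite ltxx.
  by rewrite h -EFinD addrAC subrr add0r.
apply/seteqP; split => t /=; rewrite !in_itv /=.
  by move=> [/eqP + t0]; rewrite tree_path_cell.
suff h : forall v, tree_left v <= t < tree_left v + c v -> 0 <= t < c [::].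
  by move=> tw; split; [apply/eqP; rewrite tree_path_cell// (h w)|exact: (h w)].
elim/last_ind => [|v b IH]; first by rewrite /tree_left big_ord0 add0r.
rewrite tree_left_rcons => /andP[h1 h2]; apply: IH.
have := c_split v; have := c_ge0 (rcons v false); have := c_ge0 (rcons v true).
by case: b h1 h2 => h1 h2 *; apply/andP; split; lra.
Qed.

Lemma tree_integral n (G : seq bool -> R) : (forall w, 0 <= G w) ->
  (\int[tree_measure]_t (G (tree_path t n))%:E =
   (\sum_(w : n.-tuple bool) G w * c w)%:E)%E.
Proof.
move=> G0; pose I (w : seq bool) := [set t : measurableTypeR R | tree_path t n = w].
rewrite (eq_integral (fun t => \sum_(w : n.-tuple bool)
    (G w)%:E * (\1_(I w) t)%:E)%E); last first.
  move=> t _; have st : size (tree_path t n) == n by rewrite size_tree_path.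
  rewrite (bigD1 (Tuple st))//= big1 => [|w wt].
    by rewrite adde0 indicE mem_set// mule1.
  rewrite indicE memNset ?mule0// => /= h; move/negP: wt; apply.
  by apply/eqP/val_inj; rewrite /= h.
rewrite ge0_integral_sum//=; last 2 first.
- move=> w; apply/measurable_EFinP; apply: measurable_funM => //.
  by apply: measurable_indic; exact: measurable_tree_cell.
- by move=> w t _; rewrite mule_ge0// lee_fin.
rewrite -sumEFin; apply: eq_bigr => w _.
rewrite ge0_integralZl_EFin//=; last first.
  apply/measurable_EFinP.
  by apply: measurable_indic; exact: measurable_tree_cell.
rewrite integral_indic//; last exact: measurable_tree_cell.
by rewrite setIT EFinM -(tree_measure_cell w) size_tuple.
Qed.

End BinaryTree.

(** * Haviland's theorem for an adapted space on R^d *)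

Section Haviland.
Variables (R : realType) (d : nat).
Let T := 'rV[R]_d.
Variables (K : set T) (E : set (T -> R)) (L : (T -> R) -> R).
Hypothesis K_closed : closed K.
Hypothesis ED : forall f g, E f -> E g -> E (fun x => f x + g x).
Hypothesis EZ : forall a f, E f -> E (fun x => a * f x).
Hypothesis LD : forall f g, E f -> E g -> L (fun x => f x + g x) = L f + L g.
Hypothesis LZ : forall a f, E f -> L (fun x => a * f x) = a * L f.
Hypothesis Lge0 : forall f, E f -> (forall x, K x -> 0 <= f x) -> 0 <= L f.
Hypothesis E_continuous : forall f, E f -> continuous f.
Hypothesis E1 : E (fun=> 1).
Hypothesis E_sqr : E (fun x => \sum_i x 0 i ^+ 2).
Hypothesis E_dom : forall f, E f -> exists2 g, E g &
  forall e, 0 < e -> exists C, forall x, K x -> `|f x| <= e * g x + C.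

Definition coord_index (i : 'I_d) (r : rat) : nat := pickle (i, r).

(** A number that codes no pair gets the constant digit [false]: such a level splits nothing, and
    all levels can be indexed by the naturals. *)
Definition coord_digit (k : nat) (x : T) : bool :=
  if unpickle k is Some (i, r) then ratr (r : rat) <= x 0 (i : 'I_d) else false.

Definition coord_code (x : T) (m : nat) : seq bool :=
  mkseq (coord_digit ^~ x) m.

Lemma coord_digitE (i : 'I_d) (r : rat) (x : T) :
  coord_digit (coord_index i r) x = (ratr r <= x 0 i).
Proof. by rewrite /coord_digit /coord_index pickleK. Qed.

Lemma size_coord_code x m : size (coord_code x m) = m.
Proof. exact: size_mkseq. Qed.

Lemma take_coord_code x m n : (m <= n)%N ->
  take m (coord_code x n) = coord_code x m.
Proof. by move=> mn; rewrite /coord_code /mkseq -map_take take_iota (minn_idPl mn). Qed.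

Lemma coord_nbhs (x : T) (A : set T) : nbhs x A ->
  exists2 e, 0 < e & forall y : T, (forall i, `|y 0 i - x 0 i| < e) -> A y.
Proof.
move=> /nbhs_ballP[e /= e0 eA]; exists e => // y xy; apply: eA.
by split => // i j; rewrite ord1 /ball /= distrC.
Qed.

Definition cell_weights (c : seq bool -> R) :=
  forall g (s : seq (R * seq bool)), E g ->
  (forall x, K x ->
     0 <= g x + \sum_(p <- s) p.1 * (coord_code x (size p.2) == p.2)%:R) ->
  0 <= L g + \sum_(p <- s) p.1 * c p.2.

Lemma cell_weights_exist : exists c, cell_weights c.
Proof.
pose h k (x : T) : R :=
  if unpickle k is Some w then (coord_code x (size w) == w)%:R else 0.
have [|c0 c0P] := positive_extension (h := h) ED EZ LD LZ Lge0.
  move=> k; exists (fun=> 1) => // x _; rewrite /h.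
  by case: unpickle => [w|]; rewrite ?normr0// normr_nat lern1 leq_b1.
exists (fun w => c0 (pickle w)) => g s Eg gs.
have := c0P g [seq (p.1, pickle p.2) | p <- s] Eg.
rewrite big_map /=; apply => x Kx; rewrite big_map.
rewrite (eq_bigr (fun p : R * seq bool =>
  p.1 * (coord_code x (size p.2) == p.2)%:R)) ?gs// => p _.
by rewrite /h -[(_, _).2]/(pickle p.2) pickleK.
Qed.

(** * From cell weights to a representing measure *)

Section Weights.
Variable c : seq bool -> R.
Hypothesis cP : cell_weights c.

Let LN : L (fun=> 0) = 0.
Proof.
rewrite -[RHS](mul0r (L (fun=> 1))) -LZ//.
by congr L; apply/funext => x; rewrite mul0r.
Qed.

Let E0 : E (fun=> 0).
Proof.
by rewrite (_ : (fun=> 0) = (fun x => 0 * 1 : R)); [exact: EZ | rewrite mul0r].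
Qed.

Let c_list (s : seq (R * seq bool)) :
  (forall x, K x -> 0 <= \sum_(p <- s) p.1 * (coord_code x (size p.2) == p.2)%:R) ->
  0 <= \sum_(p <- s) p.1 * c p.2.
Proof.
move=> h; have := cP E0 (s := s); rewrite LN add0r; apply => x Kx.
by rewrite add0r; exact: h.
Qed.

Lemma weight_ge0 w : 0 <= c w.
Proof.
have := @c_list [:: (1, w)]; rewrite !big_seq1 mul1r; apply => x Kx.
by rewrite big_seq1 mul1r ler0n.
Qed.

Let code_split x w : (coord_code x (size w) == w)%:R =
  (coord_code x (size w).+1 == rcons w false)%:R +
  (coord_code x (size w).+1 == rcons w true)%:R :> R.
Proof.
rewrite /coord_code mkseqS !eqseq_rcons.
case: (_ == w); last by rewrite !andFb addr0.
by case: coord_digit; rewrite !andTb /= ?addr0 ?add0r.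
Qed.

(** The indicators satisfy this identity everywhere, so the combination and its opposite are both
    nonnegative on K. *)
Lemma weight_split w : c w = c (rcons w false) + c (rcons w true).
Proof.
apply/eqP; rewrite eq_le; apply/andP; split.
  have := @c_list [:: (-1, w); (1, rcons w false); (1, rcons w true)].
  rewrite !big_cons !big_nil /= => h; suff : 0 <= - c w +
    (c (rcons w false) + c (rcons w true)) by lra.
  have := h _; rewrite mulN1r !mul1r addr0; apply => x Kx.
  by rewrite !big_cons big_nil /= !size_rcons code_split; lra.
have := @c_list [:: (1, w); (-1, rcons w false); (-1, rcons w true)].
rewrite !big_cons !big_nil /= => h; suff : 0 <= c w +
  (- c (rcons w false) - c (rcons w true)) by lra.
have := h _; rewrite !mulN1r !mul1r addr0; apply => x Kx.
by rewrite !big_cons big_nil /= !size_rcons code_split; lra.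
Qed.

Lemma weight_nil : c [::] = L (fun=> 1).
Proof.
apply/eqP; rewrite eq_le; apply/andP; split.
  have := @cP (fun=> 1) [:: (-1, [::])] E1; rewrite big_seq1 mulN1r subr_ge0.
  by apply => x _; rewrite big_seq1 /= mulr1 subrr.
have := @cP _ [:: (1, [::])] (EZ (-1) E1); rewrite big_seq1 LZ// mulN1r mul1r.
rewrite mulN1r [- _ + _]addrC subr_ge0; apply => x _.
by rewrite big_seq1 /= mulr1 addNr.
Qed.

(** The left side is the value of the extended functional at a step function that lies below g on
    K. *)
Lemma weight_step_le n (G : seq bool -> R) g : E g ->
  (forall x, K x -> G (coord_code x n) <= g x) ->
  \sum_(w : n.-tuple bool) G w * c w <= L g.
Proof.
move=> Eg Gg.
pose s := [seq (- G (val w), val w) | w <- enum {: n.-tuple bool}].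
have sE u : \sum_(p <- s) p.1 * u p.2 = - \sum_(w : n.-tuple bool) G w * u (val w).
  by rewrite /s big_map big_enum -sumrN; apply: eq_bigr => w _; rewrite mulNr.
have := @cP g s Eg; rewrite sE subr_ge0; apply => x Kx.
rewrite (sE (fun w => (coord_code x (size w) == w)%:R)) subr_ge0.
have st : size (coord_code x n) == n by rewrite size_coord_code.
rewrite (bigD1 (Tuple st))//= big1 => [|w wt].
  by rewrite size_coord_code eqxx mulr1 addr0 Gg.
rewrite size_tuple (_ : _ == _ = false) ?mulr0//.
by apply/negbTE; apply: contra wt => /eqP h; apply/eqP/val_inj; rewrite /= -h.
Qed.

(** If the cell misses K, minus its indicator is nonnegative on K, which forces a weight at most
    0. *)
Lemma weight_cell w : 0 < c w -> exists2 x, K x & coord_code x (size w) = w.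
Proof.
move=> cw; apply: contrapT => nx.
have := @c_list [:: (-1, w)]; rewrite !big_seq1 => h.
have : 0 <= -1 * c w.
  apply: h => x Kx; rewrite big_seq1 (_ : _ == _ = false) ?mulr0//.
  by apply/negbTE/eqP => h; apply: nx; exists x.
by rewrite mulN1r oppr_ge0 leNgt cw.
Qed.

Local Notation path := (tree_path c).
Local Notation digit := (tree_digit c).
Local Notation m0 := (tree_measure c).

Lemma path_cell t n : 0 <= t < c [::] ->
  exists2 x, K x & coord_code x n = path t n.
Proof.
move=> tM; have := tree_path_cell weight_ge0 weight_split (path t n) tM.
rewrite size_tree_path eqxx => /esym/andP[h1 h2].
have [|x Kx xt] := @weight_cell (path t n); first lra.
by exists x => //; rewrite size_tree_path in xt.
Qed.

(** For each coordinate the digits cut the rationals into two nonempty classes, so no coordinate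
    escapes to infinity; [limit_point] takes the real number at each cut. *)
Definition good t := 0 <= t < c [::] /\ forall i : 'I_d,
  (exists r, digit t (coord_index i r)) /\ (exists r, ~~ digit t (coord_index i r)).

Definition limit_point t : T :=
  \row_i sup [set ratr r | r in [set r : rat | digit t (coord_index i r)]].

Lemma digit_le t x m k : coord_code x m = path t m -> (k < m)%N ->
  digit t k = coord_digit k x.
Proof.
by move=> xt km; rewrite -(nth_tree_path _ _ km) -xt nth_mkseq.
Qed.

(** Choose rationals on both sides of the cut, each within e of it; a point with these two digits
    has its coordinate between them. *)
Lemma limit_point_near t e : good t -> 0 < e -> exists m, forall x,
  coord_code x m = path t m -> forall i, `|x 0 i - limit_point t 0 i| < e.
Proof.
move=> [tM gt] e0.
suff /choice[m mP] : forall i, exists m, forall x,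
    coord_code x m = path t m -> `|x 0 i - limit_point t 0 i| < e.
  exists (\max_i m i) => x xt i; apply: mP.
  have mi : (m i <= \max_i m i)%N by exact: leq_bigmax.
  by rewrite -(take_coord_code _ mi) xt take_tree_path.
move=> i; have [[r1 r1t] [r2 r2t]] := gt i.
pose A : set R := [set ratr r | r in [set r : rat | digit t (coord_index i r)]].
(* The digits at different rationals are consistent because some actual point of K has all of them
   up to the larger index. *)
have ubA : ubound A (ratr r2).
  move=> _ [r /= rt <-].
  have [x _ xt] := path_cell (maxn (coord_index i r) (coord_index i r2)).+1 tM.
  move: rt r2t; rewrite !(digit_le xt) ?ltnS ?leq_maxl ?leq_maxr//.
  by rewrite !coord_digitE -ltNge => h1 h2; exact: ltW (le_lt_trans h1 h2).
have supA : has_sup A by split; [exists (ratr r1), r1 | exists (ratr r2)].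
have [_ [r rt <-] hr] := sup_adherent e0 supA.
have [r' r'in] := @rat_in_itvoo R (sup A) (sup A + e) ltac:(by rewrite ltrDl).
move: r'in; rewrite in_itv /= => /andP[r'1 r'2].
have r't : ~~ digit t (coord_index i r').
  apply/negP => h; move: r'1; rewrite ltNge => /negP; apply.
  by apply: ub_le_sup; [exact: supA.2 | exists r'].
exists (maxn (coord_index i r) (coord_index i r')).+1 => x xt.
move: rt r't; rewrite /= !(digit_le xt) ?ltnS ?leq_maxl ?leq_maxr//.
rewrite !coord_digitE -ltNge mxE -/A => h1 h2.
rewrite ltr_norml; apply/andP; split; lra.
Qed.

Lemma limit_point_closed t : good t -> K (limit_point t).
Proof.
move=> gt; apply: K_closed => A /coord_nbhs[e e0 eA].
have [m mP] := limit_point_near gt e0.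
have [x Kx xt] := path_cell m gt.1.
by exists x; split => //; apply: eA; exact: mP.
Qed.

(** A point deep in the cells of t' is close to both limit points. The depth m depends on t only, as
    continuity at t demands. *)
Lemma limit_point_path t e : good t -> 0 < e -> exists m, forall t', good t' ->
  path t' m = path t m -> forall i, `|limit_point t' 0 i - limit_point t 0 i| < e.
Proof.
move=> gt e0; have e20 : 0 < e / 2 by rewrite divr_gt0.
have [m mP] := limit_point_near gt e20; exists m => t' gt' tt' i.
have [m' mP'] := limit_point_near gt' e20.
have [x _ xt'] := path_cell (maxn m m') gt'.1.
have := mP x; have := mP' x.
rewrite -(take_coord_code _ (leq_maxl m m')) -(take_coord_code _ (leq_maxr m m')).
rewrite xt' !take_tree_path ?leq_maxl ?leq_maxr// tt' => /(_ erefl i) h1.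
move=> /(_ erefl i); move: h1; rewrite !ltr_norml => /andP[h1 h2] /andP[h3 h4].
by apply/andP; split; lra.
Qed.

(** The i-th coordinate is at least every positive j if b is [false], and below every - j if b is
    [true]: escape to plus or minus infinity. *)
Definition bad (i : 'I_d) (b : bool) : set R :=
  \bigcap_(j in [set j | (0 < j)%N])
    [set t | digit t (coord_index i ((-1) ^+ b * j%:R)) = ~~ b].

(** Off the left endpoints, t is interior to each of its half-open intervals, so every prefix of its
    path is locally constant. The endpoints are countable, hence null. *)
Definition interior_good : set R := `[0, c [::][%classic `\`
  (\bigcup_(p in [set: 'I_d * bool]) bad p.1 p.2 `|` range (tree_left c)).

Lemma interior_good_good t : interior_good t -> good t.
Proof.
move=> [tM /not_orP[nb _]]; split => [|i]; first by move: tM; rewrite /= in_itv.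
have dig b : exists r, digit t (coord_index i r) = b.
  apply: contrapT => /forallNP nd; apply: nb; exists (i, b) => // j _ /=.
  by have := nd ((-1) ^+ b * j%:R); case: digit; case: (b).
split; first by have [r rt] := dig true; exists r.
by have [r rt] := dig false; exists r; rewrite rt.
Qed.

Lemma limit_point_continuous : {within interior_good, continuous limit_point}.
Proof.
apply/subspace_continuousP => t tD A /coord_nbhs[e e0 eA].
have gt := interior_good_good tD.
have [m mP] := limit_point_path gt e0.
have := tree_path_cell weight_ge0 weight_split (path t m) gt.1.
rewrite size_tree_path eqxx => /esym/andP[h1 h2].
have {}h1 : tree_left c (path t m) < t.
  rewrite lt_neqAle h1 andbT; apply/eqP => tE.
  by case: tD => _ /not_orP[_]; apply; exists (path t m).
suff : \forall t' \near t, interior_good t' -> A (limit_point t') by [].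
near=> t' => /interior_good_good gt'; apply: eA; apply: mP => //; apply/eqP.
rewrite -{1}(size_tree_path c t m) tree_path_cell ?gt'.1//; last 2 first.
- exact: weight_ge0.
- exact: weight_split.
apply/andP; split; last by near: t'; exact: lt_nbhsl.
by apply: ltW; near: t'; exact: lt_nbhsr.
Unshelve. all: by end_near. Qed.

(** Chebyshev's inequality: on K the indicator of this digit is at most |x|^2 / j^2, a function in
    E. *)
Let measure_digit (i : 'I_d) (b : bool) (j : nat) : (0 < j)%N ->
  (m0 [set t | digit t (coord_index i ((-1) ^+ b * j%:R)) = ~~ b] <=
   (L (fun x => \sum_i x 0 i ^+ 2)%R / j%:R ^+ 2)%:E)%E.
Proof.
move=> j0; set k := coord_index _ _.
pose G w : R := (nth false w k == ~~ b)%:R.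
have mA : measurable [set t : measurableTypeR R | digit t k = ~~ b].
  exact: (measurable_tree_pred c _ (fun w => nth false w k = ~~ b)).
rewrite -[X in m0 X]setIT -integral_indic//.
rewrite (_ : (fun x => _) = (fun t => (G (path t k.+1))%:E)); last first.
  by apply/funext => t; rewrite indicE /G; congr ((nat_of_bool _)%:R%:E); apply/idP/eqP;
    [rewrite inE | move=> h; rewrite inE].
rewrite tree_integral; [|exact: weight_ge0|exact: weight_split|by move=> w; exact: ler0n].
rewrite lee_fin mulrC -LZ//; apply: weight_step_le; first exact: EZ.
move=> x Kx; rewrite /G nth_mkseq// coord_digitE.
have jR : 0 < j%:R :> R by rewrite ltr0n.
have S0 : x 0 i ^+ 2 <= \sum_i x 0 i ^+ 2.
  by rewrite (bigD1 i)//= lerDl; apply: sumr_ge0 => *; exact: sqr_ge0.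
rewrite rmorphM rmorphXn rmorphN1 rmorph_nat ler_pdivlMl ?exprn_gt0//.
have [h|_] := eqVneq; last by rewrite mulr0; apply: le_trans S0; exact: sqr_ge0.
rewrite mulr1; apply: le_trans S0; case: b h {mA G k} => /=.
  by move/negbT; rewrite expr1 mulN1r -ltNge; nra.
by rewrite expr0 mul1r => h; have {}h : j%:R <= x 0 i by []; nra.
Qed.

Let measurable_bad i b : measurable (bad i b : set (measurableTypeR R)).
Proof.
apply: bigcap_measurable => [|j _]; first by exists 1%N.
exact: (measurable_tree_pred c _ (fun w => nth false w _ = ~~ b)).
Qed.

Let bad0 i b : m0 (bad i b) = 0%E.
Proof.
apply/eqP; rewrite eq_le measure_ge0 andbT; apply/lee_addgt0Pr => e e0.
rewrite add0e; set N := L (fun x => \sum_i x 0 i ^+ 2).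
have N0 : 0 <= N.
  by apply: Lge0 => // x _; apply: sumr_ge0 => *; exact: sqr_ge0.
(* N / e < j together with 1 <= j gives N <= e j^2. *)
pose j := (Num.truncn (N / e)).+1.
have jR : 1 <= j%:R :> R by rewrite ler1n.
apply: (@le_trans _ _ (N / j%:R ^+ 2)%:E).
  apply: le_trans (@measure_digit i b j _) => //.
  apply: le_measure; rewrite ?inE//.
    exact: (measurable_tree_pred c _ (fun w => nth false w _ = ~~ b)).
  by move=> t; exact.
rewrite lee_fin ler_pdivrMr ?exprn_gt0 ?(lt_le_trans ltr01 jR)//.
have : N / e < j%:R by exact: truncnS_gt.
rewrite ltr_pdivrMr//; move: (j%:R) jR => y y1 Ny.
have : 0 <= e * y * (y - 1) by rewrite !mulr_ge0 ?subr_ge0//; lra.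
lra.
Qed.

Let countable_ends : countable (range (tree_left c)).
Proof. exact: card_le_trans (card_image_le _ _) (countableP _). Qed.

Lemma measurable_interior_good :
  measurable (interior_good : set (measurableTypeR R)).
Proof.
apply: measurableD; first exact: measurable_itv.
apply: measurableU; first by apply: fin_bigcup_measurable.
by apply: countable_measurable => // x; exact: measurable_set1.
Qed.

Lemma interior_good_ae : m0 (~` interior_good) = 0%E.
Proof.
apply/negligibleP; first by apply: measurableC; exact: measurable_interior_good.
rewrite /interior_good setDE setCI setCK.
apply: negligibleU.
  apply/negligibleP; first by apply: measurableC; exact: measurable_itv.
  by rewrite /= /tree_measure /mrestr setIC setICr measure0.
apply: negligibleU; last first.
  apply/negligibleP.
    by apply: countable_measurable => // x; exact: measurable_set1.
  apply: countable_lebesgue_measure0; apply: sub_countable countable_ends.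
  by apply: subset_card_le; exact: subIsetl.
pose F k := if unpickle k is Some p then bad p.1 p.2 else set0.
apply: (negligibleS (A := \bigcup_k (F k : set (measurableTypeR R)))).
  by move=> t [p _ pt]; exists (pickle p) => //; rewrite /F pickleK.
apply: negligible_bigcup => k; rewrite /F.
case: unpickle => [p|]; last exact: negligible_set0.
by apply/negligibleP; [exact: measurable_bad | exact: bad0].
Qed.

Local Notation borel := (g_sigma_algebraType (@open T)).

(** The default 0 need not lie in K; it is taken only on a null set. *)
Definition representing_map (t : measurableTypeR R) : borel :=
  if pselect (interior_good t) then limit_point t else 0.

Let representing_mapE t : interior_good t -> representing_map t = limit_point t.
Proof. by move=> tD; rewrite /representing_map; case: pselect. Qed.

Let mrep : measurable_fun setT representing_map.
Proof.
apply: (measurability (@open T : set (set borel))) => // _ [U oU <-].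
have oX : open (limit_point @^-1` U : set (subspace interior_good)).
  by move/continuousP : limit_point_continuous; exact.
have [V oV VD] := (open_subspaceP _ _).1 oX.
have mV : measurable (V : set (measurableTypeR R)) by exact: open_measurable.
rewrite setTI (_ : _ @^-1` _ = (V `&` interior_good) `|`
  (~` interior_good `&` (fun=> 0) @^-1` U)).
  apply: measurableU; first by apply: measurableI => //; exact: measurable_interior_good.
  apply: measurableI; first by apply: measurableC; exact: measurable_interior_good.
  by rewrite preimage_cst; case: ifP.
rewrite VD; apply/seteqP; split => t; rewrite /preimage /mkset /representing_map.
  by case: pselect => tD tU; [left|right].
by case: pselect => tD [[]|[]].
Qed.

Definition representing_measure : set borel -> \bar R :=
  pushforward m0 representing_map.

Let mu0 : representing_measure set0 = 0%E.
Proof. exact: measure0. Qed.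

Let mu_ge0 A : (0 <= representing_measure A)%E.
Proof. exact: measure_ge0. Qed.

Let mu_sigma_additive : semi_sigma_additive representing_measure.
Proof. exact: measure_semi_sigma_additive. Qed.

HB.instance Definition _ := isMeasure.Build _ _ _ representing_measure
  mu0 mu_ge0 mu_sigma_additive.

Local Notation mu := representing_measure.

Let muE A : mu A = m0 (representing_map @^-1` A). Proof. by []. Qed.

Let mu_setT : mu setT = (L (fun=> 1))%:E.
Proof.
by rewrite muE preimage_setT (tree_measure_setT weight_ge0) weight_nil.
Qed.

Let mu_compl : mu (~` K) = 0%E.
Proof.
apply/eqP; rewrite eq_le measure_ge0 andbT -interior_good_ae.
have mK : measurable (~` K : set borel).
  by apply: sub_sigma_algebra; exact: closed_openC.
rewrite muE; apply: le_measure; rewrite ?inE.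
- by rewrite -[X in measurable X]setTI; exact: mrep.
- by apply: measurableC; exact: measurable_interior_good.
move=> t; rewrite /preimage /mkset => nK tD; apply: nK.
by rewrite representing_mapE//; exact/limit_point_closed/interior_good_good.
Qed.

Let compact_borel (C : set T) : compact C -> measurable (C : set borel).
Proof.
move=> cC; rewrite -[C]setCK; apply: measurableC; apply: sub_sigma_algebra.
by apply: closed_openC; apply: compact_closed cC; exact: norm_hausdorff.
Qed.

(** Inside [interior_good] the restricted measure is Lebesgue measure itself, so that Lebesgue
    regularity applies. *)
Let mu_lebesgue (A : set borel) : measurable A ->
  mu A = lebesgue_measure (representing_map @^-1` A `&` interior_good).
Proof.
move=> mA; have mD := measurable_interior_good.
have mXA : measurable (representing_map @^-1` A).
  by rewrite -[X in measurable X]setTI; exact: mrep.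
rewrite muE (measureDI m0 mXA mD) (subset_measure0 _ _ _ interior_good_ae)//.
- rewrite add0e /= /tree_measure /mrestr setIidl//.
  by move=> t [_ []].
- exact: measurableD.
- exact: measurableC.
Qed.

(* Lebesgue measure is inner regular and [limit_point] is continuous on
   [interior_good], so compact sets push forward to compact sets. *)
Let mu_inner_regular (A : set borel) : measurable A ->
  mu A = ereal_sup [set mu C | C in [set C : set T | compact C /\ C `<=` A]].
Proof.
move=> mA; apply/eqP; rewrite eq_le; apply/andP; split; last first.
  apply: ge_ereal_sup => _ [C [cC CA] <-].
  by apply: le_measure; rewrite ?inE//; exact: compact_borel.
have mD := measurable_interior_good.
set B := representing_map @^-1` A `&` interior_good.
have mB : measurable (B : set (measurableTypeR R)).
  by apply: measurableI => //; rewrite -[X in measurable X]setTI; exact: mrep.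
have Bfin : (lebesgue_measure B < +oo)%E.
  rewrite -mu_lebesgue//; apply: (@le_lt_trans _ _ (mu setT)).
    by apply: le_measure; rewrite ?inE.
  by rewrite mu_setT ltry.
apply/lee_addgt0Pr => e e0.
have [V [cV VB BV]] := lebesgue_regularity_inner mB Bfin e0.
have mV : measurable (V : set (measurableTypeR R)) by exact: compact_measurable.
have VD : V `<=` interior_good by move=> t /VB[].
have cXV : compact (representing_map @` V : set T).
  rewrite (_ : _ @` V = limit_point @` V).
    by apply: continuous_compact => //; exact: continuous_subspaceW limit_point_continuous.
  by apply: eq_imagel => t /VD; exact: representing_mapE.
rewrite mu_lebesgue// -/B -(setDKU VB) setUC.
apply: le_trans (measureU2 _ _ _) _ => //; first exact: measurableD.
apply: leeD; last exact: ltW.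
apply: (@le_trans _ _ (mu (representing_map @` V))); last first.
  apply: ereal_sup_ubound; exists (representing_map @` V) => //.
  by split => // _ [t /VB[]+ _ <-].
rewrite mu_lebesgue; last exact: compact_borel.
apply: le_measure; rewrite ?inE//.
  apply: measurableI => //; rewrite -[X in measurable X]setTI; apply: mrep => //.
  exact: compact_borel.
by move=> t Vt; split; [exists t | exact: VD].
Qed.

Lemma continuous_borel (f : T -> R) : continuous f ->
  measurable_fun setT (f : borel -> R).
Proof.
move=> cf; apply: (measurability _ (RGenOInfty.measurableE R)).
move=> _ [_ [r ->] <-]; rewrite setTI; apply: sub_sigma_algebra.
by move/continuousP : cf; apply; exact: interval_open.
Qed.

Let inf_cell (f : T -> R) n w :=
  inf [set f x | x in [set x | K x /\ coord_code x n = w]].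

(* Fatou's lemma, applied to the infima of [f] over the shrinking cells. *)
Let fatou_cells f : E f -> (forall x, K x -> 0 <= f x) ->
  (\int[m0]_(t in interior_good) (f (limit_point t))%:E <= (L f)%:E)%E.
Proof.
move=> Ef f0; have mD := measurable_interior_good.
pose phi n t := (inf_cell f n (path t n))%:E.
have lbc n w : lbound [set f x | x in [set x | K x /\ coord_code x n = w]] 0.
  by move=> _ [x [Kx _] <-]; exact: f0.
have inf0 n w : 0 <= inf_cell f n w.
  rewrite /inf_cell; set A := [set _ | _ in _].
  (* A cell may miss K; the infimum of the empty set is 0 by convention. *)
  have [->|/set0P A0] := eqVneq A set0; first by rewrite inf0.
  by apply: lb_le_inf => //; exact: lbc.
have mphi n : measurable_fun setT (phi n : measurableTypeR R -> \bar R).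
  apply/measurable_EFinP => _ Y mY; rewrite setTI.
  exact: (measurable_tree_pred c n (fun w => Y (inf_cell f n w))).
have mphiD n : measurable_fun (interior_good : set (measurableTypeR R)) (phi n).
  exact: measurable_funS (mphi n).
have int_phi n : (\int[m0]_(t in interior_good) phi n t <= (L f)%:E)%E.
  apply: (@le_trans _ _ (\int[m0]_t phi n t)%E).
    by apply: ge0_subset_integral => // t _; rewrite lee_fin.
  rewrite (tree_integral weight_ge0 weight_split n (inf0 n)).
  rewrite lee_fin; apply: weight_step_le => // x Kx.
  by apply: ge_inf; [exists 0; exact: lbc | exists x].
have lim_einfs m u : (einfs u m <= limn_einf u)%E.
  rewrite limn_einf_lim.
  have /cvg_lim -> // := ereal_nondecreasing_cvgn (nondecreasing_einfs u).
  by apply: ereal_sup_ubound; exists m.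
(* By continuity of f at the limit point, its infima over all deep cells on the path of t are at
   least f (X t) - e. *)
have f_le t : interior_good t ->
    ((f (limit_point t))%:E <= limn_einf (phi ^~ t))%E.
  move=> tD; have gt := interior_good_good tD.
  apply/lee_addgt0Pr => e e0.
  have /cvgrPdist_lt /(_ e e0) : f x @[x --> limit_point t] --> f (limit_point t).
    exact: E_continuous.
  move=> /coord_nbhs[e' e'0 fe']; have [m mP] := limit_point_near gt e'0.
  rewrite -leeBlDr//; apply: (@le_trans _ _ (einfs (phi ^~ t) m)); last exact: lim_einfs.
  apply: le_ereal_inf_tmp => _ [n /= mn <-]; rewrite lee_fin.
  apply: lb_le_inf.
    by have [x Kx xt] := path_cell n gt.1; exists (f x), x.
  move=> _ [x [Kx xt] <-].
  have : `|f (limit_point t) - f x| < e.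
    apply: fe'; apply: mP.
    by rewrite -(take_coord_code _ mn) xt take_tree_path.
  by rewrite ltr_norml => /andP[]; lra.
apply: (@le_trans _ _ (\int[m0]_(t in interior_good) limn_einf (phi ^~ t))%E).
  apply: ge0_le_integral => //.
  - by move=> t tD; rewrite lee_fin f0//; exact/limit_point_closed/interior_good_good.
  - apply/measurable_EFinP; apply: (eq_measurable_fun (f \o representing_map)).
      by move=> t /set_mem tD; rewrite /= representing_mapE.
    apply: measurable_funTS; apply: measurableT_comp mrep.
    by apply: continuous_borel; exact: E_continuous.
  - rewrite /limn_einf; apply: measurableT_comp => //.
    apply: (measurable_fun_limn_esup (f := fun n t => - phi n t)%E) => n.
    by apply: measurableT_comp => //; exact: mphiD.
apply: (le_trans (fatou _ mD mphiD _)); first by move=> n t _; rewrite lee_fin.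
rewrite limn_einf_lim; apply: lime_le; first exact: is_cvg_einfs.
apply: nearW => n; apply: le_trans (int_phi n).
by apply: ereal_inf_lbound; exists n => /=.
Qed.

Let mK : measurable (K : set borel).
Proof.
by rewrite -[K]setCK; apply: measurableC; apply: sub_sigma_algebra; exact: closed_openC.
Qed.

Let mEK f : E f -> measurable_fun (K : set borel) (EFin \o f : borel -> \bar R).
Proof.
move=> Ef; apply/measurable_EFinP; apply: measurable_funTS.
by apply: continuous_borel; exact: E_continuous.
Qed.

Let integral_le f : E f -> (forall x, K x -> 0 <= f x) ->
  (\int[mu]_(x in K) (f x)%:E <= (L f)%:E)%E.
Proof.
move=> Ef f0; apply: le_trans (fatou_cells Ef f0).
have mD := measurable_interior_good.
have mXK : measurable (representing_map @^-1` K).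
  by rewrite -[X in measurable X]setTI; exact: mrep.
have mfX : measurable_fun (representing_map @^-1` K) (EFin \o f \o representing_map).
  apply/measurable_EFinP; apply: measurable_funTS; apply: measurableT_comp mrep.
  by apply: continuous_borel; exact: E_continuous.
rewrite (ge0_integral_pushforward mrep _ mK (mEK Ef)); last first.
  by move=> x /set_mem Kx; rewrite lee_fin f0.
rewrite (ge0_negligible_integral (measurableC mD) mXK mfX _ interior_good_ae); last first.
  by move=> t Kt; rewrite lee_fin f0.
rewrite (_ : _ `\` ~` _ = interior_good); last first.
  rewrite setDE setCK setIidr// => t tD; rewrite /preimage /mkset representing_mapE//.
  exact/limit_point_closed/interior_good_good.
rewrite le_eqVlt; apply/orP; left; apply/eqP; apply: eq_integral => t /set_mem tD.
by rewrite /= representing_mapE.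
Qed.

(** Domination with e = 1 bounds |f| on K by a function of E, whose integral is finite by
    [integral_le]. *)
Let E_integrable f : E f -> mu.-integrable K (EFin \o f).
Proof.
move=> Ef; have [g Eg fg] := E_dom Ef; have [C {}fg] := fg _ ltr01.
pose h x := 1 * g x + C * 1.
have Eh : E h by exact: ED (EZ _ Eg) (EZ _ E1).
have fh x : K x -> `|f x| <= h x by move=> /fg; rewrite /h !mulr1.
have h0 x : K x -> 0 <= h x by move=> /fh; exact: le_trans.
apply: (@le_integrable _ _ _ mu _ mK _ (EFin \o h)); first exact: mEK.
  by move=> x Kx; rewrite lee_fin (le_trans (fh x Kx))// ler_norm.
apply/integrableP; split; first exact: mEK.
under eq_integral => x /set_mem Kx do rewrite gee0_abs ?lee_fin ?h0//.
exact: le_lt_trans (integral_le Eh h0) (ltry _).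
Qed.

Let Rintegral_le f : E f -> (forall x, K x -> 0 <= f x) ->
  \int[mu]_(x in K) f x <= L f.
Proof.
move=> Ef f0; rewrite -lee_fin fineK; first exact: integral_le.
exact: integrable_fin_num (E_integrable Ef).
Qed.

Let mu_K : fine (mu K) = L (fun=> 1).
Proof.
suff -> : mu K = mu setT by rewrite mu_setT.
have mKC : measurable (~` K : set borel) by exact: measurableC.
rewrite -(setvU K) measureU ?setICl// -[LHS]add0e; congr (_ + _)%E.
by rewrite -mu_compl.
Qed.

(* If [e g + C - f >= 0] on [K] for all [e > 0], then Fatou's inequality for
   these functions bounds [L f] from above. *)
Let Rintegral_ge f : E f -> L f <= \int[mu]_(x in K) f x.
Proof.
move=> Ef; have [g Eg fg] := E_dom Ef.
suff h e : 0 < e -> L f <= \int[mu]_(x in K) f x + e * (L g - \int[mu]_(x in K) g x).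
  (* The sign of this defect of g is not known; if it is positive, e / a is used in place of e. *)
  move: (L g - _) h => a h; apply/ler_addgt0Pr => e e0.
  have [a0|a0] := leP a 0.
    have {}h := h 1 ltr01; apply: le_trans h _; rewrite mul1r lerD2l.
    exact: le_trans a0 (ltW e0).
  by have := h (e / a) (divr_gt0 e0 a0); rewrite divfK ?gt_eqF.
move=> e0; have [C {}fg] := fg e e0.
have Eeg : E (fun x => e * g x + C * 1) by exact: ED (EZ _ Eg) (EZ _ E1).
have Eh : E (fun x => (e * g x + C * 1) + -1 * f x) by exact: ED Eeg (EZ _ Ef).
have := Rintegral_le Eh; rewrite !(LD, LZ)//; last 3 first.
- exact: EZ.
- exact: EZ.
- exact: EZ.
rewrite (RintegralD mK (E_integrable Eeg) (E_integrable (EZ (-1) Ef))).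
rewrite (RintegralD mK (E_integrable (EZ e Eg)) (E_integrable (EZ C E1))).
rewrite (RintegralZl _ mK (E_integrable Eg)) (RintegralZl _ mK (E_integrable Ef)).
rewrite (RintegralZl _ mK (E_integrable E1)) Rintegral_cst// mu_K !mul1r => hI.
suff : forall x, K x -> 0 <= e * g x + C * 1 + -1 * f x by move=> /hI; lra.
by move=> x /fg; rewrite ler_norml => /andP[]; lra.
Qed.

Lemma weights_representation :
  exists mu : {measure set (g_sigma_algebraType (@open T)) -> \bar R},
  [/\ (mu setT < +oo)%E,
   (forall A, measurable A ->
     mu A = ereal_sup [set mu C | C in [set C : set T | compact C /\ C `<=` A]]),
   mu (~` K) = 0%E &
   forall f, E f -> mu.-integrable K (EFin \o f) /\ \int[mu]_(x in K) f x = L f].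
Proof.
have mu_fin : (mu setT < +oo)%E by rewrite mu_setT ltry.
exists mu; split=> // f Ef.
split; first exact: E_integrable.
apply/eqP; rewrite eq_le Rintegral_ge// andbT.
(* The bound holds on all of E, so at - f it is the opposite inequality. *)
have := Rintegral_ge (EZ (-1) Ef).
by rewrite LZ// (RintegralZl _ mK (E_integrable Ef)); lra.
Qed.

End Weights.

Theorem adapted_haviland :
  exists mu : {measure set (g_sigma_algebraType (@open T)) -> \bar R},
  [/\ (mu setT < +oo)%E,
   (forall A, measurable A ->
     mu A = ereal_sup [set mu C | C in [set C : set T | compact C /\ C `<=` A]]),
   mu (~` K) = 0%E &
   forall f, E f -> mu.-integrable K (EFin \o f) /\ \int[mu]_(x in K) f x = L f].
Proof.
by have [c cP] := cell_weights_exist; exact: (weights_representation cP).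
Qed.

End Haviland.

(** * Quaternion polynomials *)

Section QuaternionAlgebra.
Variable R : realType.
Implicit Types (p q : quat R).

Lemma quatM p q :
  (x0 (p * q) = x0 p * x0 q - x1 p * x1 q - x2 p * x2 q - x3 p * x3 q) *
  (x1 (p * q) = x0 p * x1 q + x1 p * x0 q + x2 p * x3 q - x3 p * x2 q) *
  (x2 (p * q) = x0 p * x2 q - x1 p * x3 q + x2 p * x0 q + x3 p * x1 q) *
  (x3 (p * q) = x0 p * x3 q + x1 p * x2 q - x2 p * x1 q + x3 p * x0 q).
Proof. by rewrite -[p * q]/(qmul p q) /qmul !mkquatE. Qed.

Lemma quat0 : (x0 (0 : quat R) = 0) * (x1 (0 : quat R) = 0) *
  (x2 (0 : quat R) = 0) * (x3 (0 : quat R) = 0).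
Proof. by rewrite /x0 /x1 /x2 /x3 !mxE. Qed.

Lemma quat1 : (x0 (1 : quat R) = 1) * (x1 (1 : quat R) = 0) *
  (x2 (1 : quat R) = 0) * (x3 (1 : quat R) = 0).
Proof. by rewrite -[1]/(qone R) /qone !mkquatE. Qed.

Lemma quatN p : (x0 (- p) = - x0 p) * (x1 (- p) = - x1 p) *
  (x2 (- p) = - x2 p) * (x3 (- p) = - x3 p).
Proof. by rewrite /x0 /x1 /x2 /x3 !mxE. Qed.

Definition quatE := (mkquatE, quatD, quatM, quat0, quat1, quatN).

Lemma quat_unitM p :
  (p * qi R = mkquat (- x1 p) (x0 p) (x3 p) (- x2 p)) *
  (p * qj R = mkquat (- x2 p) (- x3 p) (x0 p) (x1 p)) *
  (p * qk R = mkquat (- x3 p) (x2 p) (- x1 p) (x0 p)) *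
  (qi R * p = mkquat (- x1 p) (x0 p) (- x3 p) (x2 p)) *
  (qj R * p = mkquat (- x2 p) (x3 p) (x0 p) (- x1 p)) *
  (qk R * p = mkquat (- x3 p) (- x2 p) (x1 p) (x0 p)).
Proof. by do !split; apply: quatP; rewrite !quatE; ring. Qed.

Lemma quat_realM a p :
  qreal a * p = mkquat (a * x0 p) (a * x1 p) (a * x2 p) (a * x3 p).
Proof. by apply: quatP; rewrite !quatE; ring. Qed.

Lemma mkquat_eta p : mkquat (x0 p) (x1 p) (x2 p) (x3 p) = p.
Proof. by apply: quatP; rewrite !mkquatE. Qed.

Lemma qrealD (a b : R) : qreal (a + b) = qreal a + qreal b.
Proof. by apply: quatP; rewrite !quatE ?addr0. Qed.

Lemma qrealM (a b : R) : qreal (a * b) = qreal a * qreal b.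
Proof. by apply: quatP; rewrite !quatE; ring. Qed.

Lemma qreal1 : qreal 1 = 1 :> quat R.
Proof. by apply: quatP; rewrite !quatE. Qed.

Lemma qreal0 : qreal 0 = 0 :> quat R.
Proof. by apply: quatP; rewrite !quatE. Qed.

Lemma qrealN (a : R) : qreal (- a) = - qreal a.
Proof. by apply: quatP; rewrite !quatE ?oppr0. Qed.

Lemma qrealX (a : R) n : qreal (a ^+ n) = qreal a ^+ n.
Proof. by elim: n => [|n IH]; rewrite ?expr0 ?qreal1// !exprS qrealM IH. Qed.

Lemma qrealC (a : R) p : qreal a * p = p * qreal a.
Proof. by apply: quatP; rewrite !quatE; ring. Qed.

Lemma qconjM p q : qconj (p * q) = qconj q * qconj p.
Proof. by apply: quatP; rewrite /qconj !quatE; ring. Qed.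

Lemma qconjK p : qconj (qconj p) = p.
Proof. by apply: quatP; rewrite /qconj !quatE ?opprK. Qed.

Lemma qconj1 : qconj 1 = 1 :> quat R.
Proof. by apply: quatP; rewrite /qconj !quatE ?oppr0. Qed.

Lemma qconjX p n : qconj (p ^+ n) = qconj p ^+ n.
Proof.
by elim: n => [|n IH]; rewrite ?expr0 ?qconj1// exprS qconjM IH exprSr.
Qed.

Definition qnorm2 q : R := x0 q ^+ 2 + (x1 q ^+ 2 + x2 q ^+ 2 + x3 q ^+ 2).

Lemma qconj_mul q : qconj q * q = qreal (qnorm2 q).
Proof. by apply: quatP; rewrite /qconj /qnorm2 !quatE; ring. Qed.

Lemma qmul_conj q : q * qconj q = qreal (qnorm2 q).
Proof. by apply: quatP; rewrite /qconj /qnorm2 !quatE; ring. Qed.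

Lemma qconj_comm q : GRing.comm (qconj q) q.
Proof. by rewrite /GRing.comm qconj_mul qmul_conj. Qed.

Lemma qmonomE m d q : qmonom m (m + d) q = qreal (qnorm2 q ^+ m) * q ^+ d.
Proof.
by rewrite /qmonom exprD mulrA -exprMn_comm ?qconj_mul ?qrealX//; exact: qconj_comm.
Qed.

Lemma qmonom_conj m n q : qconj (qmonom m n q) = qmonom n m q.
Proof. by rewrite /qmonom qconjM !qconjX qconjK. Qed.

(* Conjugation is a two-sided linear combination of left and right products,
   which is why [H^0[q^*, q]] only needs the monomials with [m <= n]. *)
Lemma qconj_units p : qconj p =
  qreal (- 2^-1) * (p + qi R * p * qi R + qj R * p * qj R + qk R * p * qk R).
Proof. by apply: quatP; rewrite /qconj !(quat_realM, quat_unitM) !quatE; field. Qed.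

Lemma quat_units p : p = qreal (x0 p) + qreal (x1 p) * qi R +
  qreal (x2 p) * qj R + qreal (x3 p) * qk R.
Proof. by apply: quatP; rewrite !quat_realM !quatE; ring. Qed.

Definition qunit_seq : seq (quat R) := [:: 1; qi R; qj R; qk R].

Lemma qunit_seq_uniq : uniq qunit_seq.
Proof.
rewrite /= !inE !negb_or !andbT; repeat (apply/andP; split); apply/eqP => h;
  move: (congr1 (@x0 R) h) (congr1 (@x1 R) h) (congr1 (@x2 R) h) (congr1 (@x3 R) h);
  rewrite !quatE; lra.
Qed.

Lemma qunitsE (s : quat R) : qunits s <-> s \in qunit_seq.
Proof.
rewrite /qunits /qunit_seq !inE; split.
  by move=> [[[]|]|] /= ->; rewrite eqxx ?orbT.
by case/or4P => /eqP ->; [left; left; left|left; left; right|left; right|right].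
Qed.

(* The maps [p |-> p], [p |-> p i], ... are separated by evaluation at the
   units because [H (x) H] acts faithfully on [H]. *)
Lemma two_sided_faithful (a b c d : quat R) :
  (forall u, u \in qunit_seq -> a * u * 1 + b * u * qi R + c * u * qj R + d * u * qk R = 0) ->
  [/\ a = 0, b = 0, c = 0 & d = 0].
Proof.
move=> h.
have /h e0 : 1 \in qunit_seq by rewrite !inE eqxx.
have /h ei : qi R \in qunit_seq by rewrite !inE eqxx ?orbT.
have /h ej : qj R \in qunit_seq by rewrite !inE eqxx ?orbT.
have /h ek : qk R \in qunit_seq by rewrite !inE eqxx ?orbT.
move: e0 ei ej ek; rewrite !mulr1 !quat_unitM !mkquatE => e0 ei ej ek.
move: (congr1 (@x0 R) e0) (congr1 (@x1 R) e0) (congr1 (@x2 R) e0) (congr1 (@x3 R) e0)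
  (congr1 (@x0 R) ei) (congr1 (@x1 R) ei) (congr1 (@x2 R) ei) (congr1 (@x3 R) ei)
  (congr1 (@x0 R) ej) (congr1 (@x1 R) ej) (congr1 (@x2 R) ej) (congr1 (@x3 R) ej)
  (congr1 (@x0 R) ek) (congr1 (@x1 R) ek) (congr1 (@x2 R) ek) (congr1 (@x3 R) ek).
rewrite !quatD !mkquatE !quat0 => {h e0 ei ej ek} *.
by split; apply: quatP; rewrite !quat0; lra.
Qed.
End QuaternionAlgebra.

(** * Independence of polynomials on restricted sets of points *)

Section PolynomialIndependence.
Variable R : realType.
Implicit Types (p : {poly R}).

Lemma poly0_of_inj_roots p (f : nat -> R) : injective f ->
  (forall n, root p (f n)) -> p = 0.
Proof.
move=> injf rf; apply/eqP; apply: contraT => p0.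
have := @max_poly_roots _ p (mkseq f (size p)) p0.
rewrite size_mkseq ltnn; apply; last by rewrite mkseq_uniq.
by apply/allP => _ /mapP[n _ ->].
Qed.

Lemma poly0_of_pos p : (forall t, 0 < t -> p.[t] = 0) -> p = 0.
Proof.
move=> h; apply: (@poly0_of_inj_roots p (fun n => n.+1%:R)) => [m n /eqP|n].
  by rewrite eqr_nat => /eqP[].
by rewrite /root h// ltr0n.
Qed.

Lemma poly0_of_sqr_lt p t : 0 < t -> (forall x, x ^+ 2 < t -> p.[x] = 0) -> p = 0.
Proof.
(* This s satisfies s^2 < t because t < (1 + t)^2; the points s / (n + 1) are then infinitely many
   roots. *)
move=> t0 h; pose s := t / (1 + t).
have t1 : 0 < 1 + t by lra.
have s0 : 0 < s by rewrite divr_gt0.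
have st : s ^+ 2 < t.
  rewrite /s expr_div_n ltr_pdivrMr ?exprn_gt0//; nra.
apply: (@poly0_of_inj_roots p (fun n => s / n.+1%:R)) => [m n|n].
  move/(mulfI (lt0r_neq0 s0))/invr_inj/eqP.
  by rewrite eqr_nat => /eqP[].
rewrite /root h//; apply: le_lt_trans st.
have n1 : 1 <= n.+1%:R :> R by rewrite ler1n.
have sn0 : 0 <= s / n.+1%:R by rewrite divr_ge0// ltW.
rewrite ler_pXn2r// ?nnegrE//; last exact: ltW.
by rewrite ler_pdivrMr ?(lt_le_trans ltr01 n1)// ler_peMr// ltW.
Qed.

Lemma triangular_independent (p : nat -> {poly R}) (a : nat -> R) N :
  (forall d, (size (p d) <= d.+1)%N) -> (forall d, (p d)`_d != 0) ->
  \sum_(d < N) a d *: p d = 0 -> forall d, (d < N)%N -> a d = 0.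
Proof.
move=> sp pn0; elim: N => // N IH; rewrite big_ord_recr /= => h.
have aN : a N = 0.
  have := congr1 (fun q : {poly R} => q`_N) h; rewrite coefD coefZ coef0 coef_sum.
  rewrite big1 => [|d _]; last first.
    by rewrite coefZ nth_default ?mulr0// (leq_trans (sp d)).
  by rewrite add0r => /eqP; rewrite mulf_eq0 (negbTE (pn0 N)) orbF => /eqP.
move: h; rewrite aN scale0r addr0 => /IH{}IH d.
by rewrite ltnS leq_eqVlt => /predU1P[->//|]; exact: IH.
Qed.

(* [t] stands for [|q|^2] and [x] for the real part of [q], so that the two
   variables are only independent in the region [x ^+ 2 < t]. *)
Lemma bivariate_independent (p : R -> nat -> {poly R}) (a : nat -> nat -> R) M N :
  (forall t d, (size (p t d) <= d.+1)%N) -> (forall t d, (p t d)`_d != 0) ->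
  (forall t x, 0 < t -> x ^+ 2 < t ->
    \sum_(m < M) \sum_(d < N) t ^+ m * (p t d).[x] * a m d = 0) ->
  forall m d, (m < M)%N -> (d < N)%N -> a m d = 0.
Proof.
move=> sp pn0 h m d mM dN.
suff /(congr1 (fun q : {poly R} => q`_m)) : \poly_(m < M) a m d = 0.
  by rewrite coef_poly mM coef0.
apply: poly0_of_pos => t t0; rewrite horner_poly.
(* For fixed t the relation is one in x with coefficients [b d], which vanish by triangularity; then
   t varies. *)
pose b d := \sum_(m < M) a m d * t ^+ m.
apply: (@triangular_independent (p t) b N (sp t) (pn0 t) _ d dN).
apply: (poly0_of_sqr_lt t0) => x xt; rewrite -[RHS](h t x)// exchange_big.
rewrite horner_sum; apply: eq_bigr => e _; rewrite hornerZ /b mulr_suml.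
by apply: eq_bigr => i _; ring.
Qed.

(* If [q = x + y u] with [u ^+ 2 = -1] and [t = x ^+ 2 + y ^+ 2], then
   [q ^+ d = P.[x] + y Q.[x] u] for the two components [P] and [Q]. *)
Fixpoint qpow_poly (t : R) (d : nat) : {poly R} * {poly R} :=
  if d is e.+1 then
    let: (p, q) := qpow_poly t e in
    ('X * p - (t%:P - 'X ^+ 2) * q, p + 'X * q)
  else (1, 0).

(** With t fixed, y^2 = t - x^2 has degree 2 in x, so both terms of the recursion contribute equally
    and the leading coefficient doubles. For t = 1 these are the Chebyshev polynomials T_(d+1) and
    U_d. *)
Lemma qpow_poly_lead t d :
  [/\ (size (qpow_poly t d.+1).1 <= d.+2)%N,
      (qpow_poly t d.+1).1`_d.+1 = 2 ^+ d,
      (size (qpow_poly t d.+1).2 <= d.+1)%N &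
      (qpow_poly t d.+1).2`_d = 2 ^+ d].
Proof.
elim: d => [|d].
  rewrite /= mulr1 !(mulr0, subr0, addr0) size_polyX size_poly1 coefX coef1.
  by split.
have -> : qpow_poly t d.+2 = let: (p, q) := qpow_poly t d.+1 in
  ('X * p - (t%:P - 'X ^+ 2) * q, p + 'X * q) by [].
case: (qpow_poly t d.+1) => p q /=.
move=> [sp lp sq lq].
have cX2 k : ((t%:P - 'X ^+ 2) * q)`_k.+2 = t * q`_k.+2 - q`_k.
  by rewrite mulrBl coefB coefCM coefXnM !subSS subn0.
have sp' k : (d.+2 <= k)%N -> p`_k = 0 by move/leq_sizeP : sp; exact.
have sq' k : (d.+1 <= k)%N -> q`_k = 0 by move/leq_sizeP : sq; exact.
split.
- apply/leq_sizeP => -[//|[//|k]] dk; rewrite coefB coefXM /= cX2.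
  by rewrite sp'// !sq'// ?mulr0 ?subrr// ltnW// ltnW.
- rewrite coefB coefXM /= lp cX2 lq sq'//.
  by rewrite exprS; ring.
- apply/leq_sizeP => -[//|k] dk; rewrite coefD coefXM /= sp'// sq' ?addr0//.
- by rewrite coefD coefXM /= lp lq exprS; ring.
Qed.

End PolynomialIndependence.

(** * Uniqueness of the expansion in monomials *)

Section ExpansionUniqueness.
Variable R : realType.
Implicit Types (p q : quat R).

Definition qcoord (l : 'I_4) q : R := q ord0 l.

Lemma qcoord_eq0 p : (forall l, qcoord l p = 0) -> p = 0.
Proof. by move=> h; apply/rowP => l; rewrite [LHS]h mxE. Qed.

Lemma qcoord0 l : qcoord l 0 = 0.
Proof. by rewrite /qcoord mxE. Qed.

Lemma qcoordD l p q : qcoord l (p + q) = qcoord l p + qcoord l q.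
Proof. by rewrite /qcoord mxE. Qed.

Lemma qcoord_sum l I (r : seq I) (F : I -> quat R) :
  qcoord l (\sum_(i <- r) F i) = \sum_(i <- r) qcoord l (F i).
Proof. exact: (big_morph _ (qcoordD l) (qcoord0 l)). Qed.

Lemma qcoord_realM l a p : qcoord l (qreal a * p) = a * qcoord l p.
Proof.
rewrite quat_realM /qcoord /mkquat mxE /x0 /x1 /x2 /x3 -[in RHS](inord_val l).
by case: l => -[|[|[|[|]]]].
Qed.

Let imag_units : seq (quat R) := [:: qi R; qj R; qk R].

Lemma qreal_unitM (a b x y : R) (u : quat R) : u \in imag_units ->
  (qreal a + qreal b * u) * (qreal x + qreal y * u) =
  qreal (x * a - y * b) + qreal (y * a + x * b) * u.
Proof.
by rewrite !inE => /or3P[] /eqP ->; apply: quatP; rewrite !quat_unitM !quatE; ring.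
Qed.

Lemma qpow_polyE (x y : R) (u : quat R) d : u \in imag_units ->
  (qreal x + qreal y * u) ^+ d =
  qreal (qpow_poly (x ^+ 2 + y ^+ 2) d).1.[x] +
  qreal (y * (qpow_poly (x ^+ 2 + y ^+ 2) d).2.[x]) * u.
Proof.
move=> uI; elim: d => [|d IH].
  by rewrite expr0 /= hornerC hornerC mulr0 qreal0 qreal1 mul0r addr0.
rewrite exprSr IH qreal_unitM//= ; case: (qpow_poly _ d) => P Q /=.
by rewrite !(hornerD, hornerN, hornerM, hornerX, hornerXn, hornerC);
  congr (qreal _ + qreal _ * u); ring.
Qed.

Let imag_norm u x y : u \in imag_units ->
  qnorm2 (qreal x + qreal y * u) = x ^+ 2 + y ^+ 2.
Proof.
by rewrite !inE => /or3P[] /eqP ->; rewrite /qnorm2 quat_realM !quatE; ring.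
Qed.

(** The termwise identity behind [coef]: real factors commute with c, u and s. *)
Let coef_term (c u s : quat R) (t a b y : R) :
  qreal (t * a) * (c * 1 * s) + qreal (y * (t * b)) * (c * u * s) =
  c * (qreal t * (qreal a + qreal (y * b) * u)) * s.
Proof.
rewrite (mulrCA y) [in RHS]mulrDr [in RHS]mulrDr [in RHS]mulrDl mulr1.
rewrite -(mulrA c u) !mulrA (qrealC (t * a) c) (qrealC (t * y * b) c).
by rewrite -(mulrA t) !qrealM !mulrA.
Qed.

Section Box.
Variables (c : nat * nat * quat R -> quat R) (M N : nat).
Hypothesis c_index : forall t, ~ qindex t -> c t = 0.
Hypothesis c_zero : forall q, \sum_(m < M) \sum_(d < N) \sum_(s <- qunit_seq R)
  c ((m : nat), (m + d)%N, s) * qmonom m (m + d) q * s = 0.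

(** At q = x + y u the power q^d is a real combination of 1 and u, so the coefficients enter only
    through this real-linear map at 1 and at u. *)
Let A m d u := \sum_(s <- qunit_seq R) c (m, (m + d)%N, s) * u * s.

Let coef u x y l : u \in imag_units ->
  \sum_(m < M) \sum_(d < N) ((x ^+ 2 + y ^+ 2) ^+ m *
    (qpow_poly (x ^+ 2 + y ^+ 2) d).1.[x] * qcoord l (A m d 1) +
   y * ((x ^+ 2 + y ^+ 2) ^+ m *
    (qpow_poly (x ^+ 2 + y ^+ 2) d).2.[x] * qcoord l (A m d u))) = 0.
Proof.
move=> uI; have := congr1 (qcoord l) (c_zero (qreal x + qreal y * u)).
rewrite qcoord0 => E; rewrite -[RHS]E qcoord_sum; apply: eq_bigr => m _.
rewrite qcoord_sum; apply: eq_bigr => d _.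
rewrite mulrA -!qcoord_realM -qcoordD; congr qcoord.
rewrite /A !mulr_sumr -big_split; apply: eq_bigr => s _ /=.
rewrite qmonomE imag_norm// qpow_polyE//.
Qed.

(** The points x + y u and x - y u have the same x and t, so the parts even and odd in y vanish
    separately; y is nonzero as x^2 < t. *)
Let coef_parts u x t l : u \in imag_units -> x ^+ 2 < t ->
  \sum_(m < M) \sum_(d < N)
    t ^+ m * (qpow_poly t d).1.[x] * qcoord l (A m d 1) = 0 /\
  \sum_(m < M) \sum_(d < N)
    t ^+ m * (qpow_poly t d).2.[x] * qcoord l (A m d u) = 0.
Proof.
move=> uI xt; set S1 := LHS; set S2 := (X in _ /\ X = _).
pose y := Num.sqrt (t - x ^+ 2).
have y2 : y ^+ 2 = t - x ^+ 2 by rewrite sqr_sqrtr// subr_ge0 ltW.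
have y0 : y != 0 by rewrite sqrtr_eq0 -ltNge subr_gt0.
have S12 z : z ^+ 2 = t - x ^+ 2 -> S1 + z * S2 = 0.
  move=> z2; rewrite -[RHS](coef x z l uI) z2 [x ^+ 2 + _]addrC subrK mulr_sumr -big_split.
  apply: eq_bigr => m _; rewrite mulr_sumr -big_split.
  by apply: eq_bigr => d _ /=.
have h1 := S12 y y2; have h2 : S1 + - y * S2 = 0 by apply: S12; rewrite sqrrN.
have S10 : S1 = 0 by lra.
split => //; move: h1; rewrite S10 add0r => /eqP.
by rewrite mulf_eq0 (negbTE y0) => /eqP.
Qed.

Let A_even m d : (m < M)%N -> (d < N)%N -> A m d 1 = 0.
Proof.
move=> mM dN; apply: qcoord_eq0 => l.
have iI : qi R \in imag_units by rewrite !inE eqxx.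
apply: (@bivariate_independent _ (fun t d => (qpow_poly t d).1)
  (fun m d => qcoord l (A m d 1)) M N) => //.
- by move=> t [|e]; [rewrite size_poly1 | have [] := qpow_poly_lead t e].
- move=> t [|e]; first by rewrite coef1 oner_eq0.
  by have [_ -> _ _] := qpow_poly_lead t e; rewrite expf_neq0// pnatr_eq0.
- by move=> t x _ xt; have [] := coef_parts l iI xt.
Qed.

Let A_odd m d u : u \in imag_units -> (m < M)%N -> (d.+1 < N)%N -> A m d.+1 u = 0.
Proof.
move=> uI mM dN; apply: qcoord_eq0 => l.
have N0 : (0 < N)%N by exact: leq_trans dN.
apply: (@bivariate_independent _ (fun t d => (qpow_poly t d.+1).2)
  (fun m d => qcoord l (A m d.+1 u)) M N.-1) => //.
- by move=> t e; have [] := qpow_poly_lead t e.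
- move=> t e; have [_ _ _ ->] := qpow_poly_lead t e.
  by rewrite expf_neq0// pnatr_eq0.
(* The second component of [qpow_poly t 0] is 0, so the odd part starts at exponent 1 and degrees
   shift by one. *)
- move=> t x _ xt; have [_] := coef_parts l uI xt => S0; rewrite -[RHS]S0.
  apply: eq_bigr => i _; case: N N0 => // N' _; rewrite big_ord_recl /=.
  by rewrite hornerC mulr0 mul0r add0r.
- by rewrite -ltnS prednK.
Qed.

Lemma box_coef0 m d s : (m < M)%N -> (d < N)%N -> s \in qunit_seq R ->
  c (m, (m + d)%N, s) = 0.
Proof.
move=> mM dN sU; have AE u : A m d u = c (m, (m + d)%N, 1) * u * 1 +
    c (m, (m + d)%N, qi R) * u * qi R + c (m, (m + d)%N, qj R) * u * qj R +
    c (m, (m + d)%N, qk R) * u * qk R.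
  by rewrite /A /qunit_seq !big_cons big_nil addr0 !addrA.
(* On the diagonal only the value of [A] at 1 is known to vanish; it suffices because the index set
   admits only sigma = 1 there. Off the diagonal [A] vanishes at all four units. *)
case: d dN AE => [|d] dN AE.
  have c0 v : v != 1 -> c (m, (m + 0)%N, v) = 0.
    move=> v1; apply: c_index => -[[]|[]] /=; first by rewrite addn0 ltnn.
    by move=> _ h; rewrite h eqxx in v1.
  have [->|/c0//] := eqVneq s 1; have := A_even mM dN; rewrite AE.
  have := qunit_seq_uniq R; rewrite /qunit_seq /= !inE !negb_or.
  move=> /and4P[/and3P[i1 j1 k1] _ _ _].
  rewrite (c0 (qi R)) 1?eq_sym// (c0 (qj R)) 1?eq_sym// (c0 (qk R)) 1?eq_sym//.
  by rewrite !mulr1 !mul0r !addr0.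
have [|c1 ci cj ck] := @two_sided_faithful _ (c (m, (m + d.+1)%N, 1))
  (c (m, (m + d.+1)%N, qi R)) (c (m, (m + d.+1)%N, qj R)) (c (m, (m + d.+1)%N, qk R)).
  move=> u; rewrite -AE inE => /predU1P[->|uI]; first exact: A_even.
  exact: A_odd.
by move: sU; rewrite !inE => /or4P[] /eqP ->.
Qed.
End Box.
End ExpansionUniqueness.

(** * The Riesz functional on lists of terms *)

Section Riesz.
Variable R : realType.
Implicit Types (f g : quat R -> quat R) (s : seq (quat R * nat * nat * quat R)).

Local Notation index := (nat * nat * quat R)%type.

Definition qterms s (q : quat R) : quat R :=
  \sum_(e <- s) e.1.1.1 * qmonom e.1.1.2 e.1.2 q * e.2.

Definition term_index (e : quat R * nat * nat * quat R) : index :=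
  (e.1.1.2, e.1.2, e.2).

Definition normal_terms s := forall e, e \in s -> qindex (term_index e).

Let box_seq N : seq index :=
  [seq (p.1, (p.1 + p.2)%N, u) | p <- [seq (m, d) | m <- index_iota 0 N,
    d <- index_iota 0 N], u <- qunit_seq R].

Let box_seq_uniq N : uniq (box_seq N).
Proof.
apply: allpairs_uniq; first by apply: allpairs_uniq => [||[a b] [a' b'] _ _ //];
  exact: iota_uniq.
  exact: qunit_seq_uniq.
by move=> [[m d] u] [[m' d'] u'] _ _ /= [-> /addnI -> ->].
Qed.

(** Every larger box works too, so two expansions can be compared on a common one. *)
Let sum_box (a : index -> quat R) : finite_set [set t | a t != 0] ->
  [set t | a t != 0] `<=` @qindex R -> exists N0, forall N, (N0 <= N)%N ->
  forall G : index -> quat R, \sum_(t \in @qindex R) a t * G t =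
  \sum_(m < N) \sum_(d < N) \sum_(u <- qunit_seq R)
    a ((m : nat), (m + d)%N, u) * G ((m : nat), (m + d)%N, u).
Proof.
move=> /finite_seqP[r rE] aI.
exists (\max_(t <- r) t.1.2).+1 => N N0N G.
have a0 t : ~ qindex t -> a t = 0.
  by move=> nt; apply/eqP; apply: contraT => /aI.
transitivity (\sum_(t <- box_seq N) a t * G t); last first.
  rewrite big_allpairs_dep big_allpairs big_mkord; apply: eq_bigr => m _.
  by rewrite big_mkord.
rewrite (fsbig_widen _ [set: index])//; last first.
  by move=> t [_ /a0 at0] /=; rewrite at0 mul0r.
rewrite (fsbigE (box_seq N))//; first by apply: eq_bigl => t; exact: in_setT.
move=> t _ tN; have [->|at0] := eqVneq (a t) 0; first by rewrite mul0r.
move: tN => /negP[]; have tI := aI _ at0.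
have tn : (t.1.2 < N)%N.
  apply: leq_trans N0N; rewrite ltnS.
  have tr : [set` r] t by rewrite -rE.
  by rewrite (leq_bigmax_seq (F := fun t : index => t.1.2) t).
have mn : (t.1.1 <= t.1.2)%N by case: tI => -[] /=; [move/ltnW | move=> ->].
apply/allpairsP; exists ((t.1.1, (t.1.2 - t.1.1)%N), t.2) => /=; split.
- by apply/allpairsP; exists (t.1.1, (t.1.2 - t.1.1)%N); split => //=;
    rewrite mem_index_iota /=;
    [exact: leq_ltn_trans tn | exact: leq_ltn_trans (leq_subr _ _) tn].
- case: tI => -[_] /=; first by move/qunitsE.
  by move=> ->; rewrite !inE eqxx.
- by rewrite subnKC//; case: t {at0 tI tn mn} => -[].
Qed.

Lemma qexpansion_unique f a b : qexpansion f a -> qexpansion f b -> a = b.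
Proof.
move=> [fa aI fEa] [fb bI fEb]; apply/funext => t.
have [Na aN] := sum_box fa aI; have [Nb bN] := sum_box fb bI.
have out (c : index -> quat R) : [set t | c t != 0] `<=` @qindex R ->
    forall t, ~ qindex t -> c t = 0.
  by move=> cI t' nt'; apply/eqP; apply: contraT => /cI.
have [tI|nt] := pselect (qindex t); last by rewrite (out a)// (out b).
pose N := maxn (maxn Na Nb) t.1.2.+1.
have NaN : (Na <= N)%N by rewrite /N -maxnA leq_maxl.
have NbN : (Nb <= N)%N by rewrite /N maxnAC leq_maxr.
have tN : (t.1.2 < N)%N by exact: leq_maxr.
have mn : (t.1.1 <= t.1.2)%N by case: tI => -[] /=; [move/ltnW | move=> ->].
apply/subr0_eq.
have -> : t = (t.1.1, (t.1.1 + (t.1.2 - t.1.1))%N, t.2).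
  by rewrite subnKC//; case: t {tI tN mn N NaN NbN} => -[].
apply: (@box_coef0 _ (fun t => a t - b t) N N); last 3 first.
- exact: leq_ltn_trans tN.
- exact: leq_ltn_trans (leq_subr _ _) tN.
- case: tI => -[_] /=; first by move/qunitsE.
  by move=> ->; rewrite !inE eqxx.
- by move=> t' nt'; rewrite (out a)// (out b)// subr0.
move=> q; pose G (t : index) := qmonom t.1.1 t.1.2 q * t.2.
have : \sum_(t \in @qindex R) a t * G t = \sum_(t \in @qindex R) b t * G t.
  transitivity (f q); first by rewrite fEa; apply: eq_fsbigr => t' _; rewrite mulrA.
  by rewrite fEb; apply: eq_fsbigr => t' _; rewrite -mulrA.
rewrite (aN N)// (bN N)// => /eqP; rewrite -subr_eq0 => /eqP E; rewrite -[RHS]E.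
rewrite -sumrB; apply: eq_bigr => m _; rewrite -sumrB; apply: eq_bigr => d _.
by rewrite -sumrB; apply: eq_bigr => u _; rewrite -mulrBl -mulrA.
Qed.

Let coefs s (t : index) : quat R := \sum_(e <- s | term_index e == t) e.1.1.1.

Let coefs0 s t : t \notin map term_index s -> coefs s t = 0.
Proof.
move=> nt; rewrite /coefs big_seq_cond big_pred0// => e.
apply/negbTE/negP => /andP[es /eqP te]; move/negP: nt; apply.
by rewrite -te map_f.
Qed.

Let coefs_index s : normal_terms s -> [set t | coefs s t != 0] `<=` @qindex R.
Proof.
move=> sI t /= t0.
have /mapP[e es ->] : t \in map term_index s.
  by apply: contraNT t0 => /coefs0 ->.
exact: sI.
Qed.

Let sum_coefs s (G : index -> quat R) : normal_terms s ->
  \sum_(t \in @qindex R) coefs s t * G t = \sum_(e <- s) e.1.1.1 * G (term_index e).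
Proof.
move=> sI; rewrite (fsbig_widen _ [set: index])//; last first.
  move=> t [_ nt] /=; have [->|/(coefs_index sI)//] := eqVneq (coefs s t) 0.
  by rewrite mul0r.
rewrite (fsbigE (undup (map term_index s))) ?undup_uniq//; last first.
  by move=> t _; rewrite mem_undup => /coefs0 ->; rewrite mul0r.
under eq_bigl do rewrite in_setT.
under eq_bigr do rewrite /coefs mulr_suml big_mkcond /=.
rewrite exchange_big /=; apply: eq_big_seq => e es.
rewrite (bigD1_seq (term_index e)) ?undup_uniq ?mem_undup ?map_f//= eqxx.
by rewrite big1 ?addr0// => t te; rewrite eq_sym (negbTE te).
Qed.

(** Collecting repeated indices gives an expansion, which by uniqueness is the one chosen by
    [qcoeff]. From here on [riesz] is computed on any convenient list. *)
Lemma riesz_qterms S s : normal_terms s ->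
  riesz S (qterms s) = \sum_(e <- s) e.1.1.1 * S e.1.1.2 e.1.2 * e.2.
Proof.
move=> sI; have sE : qexpansion (qterms s) (coefs s).
  split; last 1 first.
  - apply/funext => q; transitivity (\sum_(t \in @qindex R)
      coefs s t * (qmonom t.1.1 t.1.2 q * t.2)); last first.
      by apply: eq_fsbigr => t _; rewrite mulrA.
    rewrite (sum_coefs (fun t => qmonom t.1.1 t.1.2 q * t.2))//.
    by apply: eq_bigr => e _; rewrite mulrA.
  - apply: sub_finite_set (finite_seq (map term_index s)) => t /= t0.
    by apply: contraNT t0 => /coefs0 ->.
  - exact: coefs_index.
have cE : qcoeff (qterms s) = coefs s.
  exact: qexpansion_unique (xgetPex _ (ex_intro _ _ sE)) sE.
rewrite /riesz cE; transitivity (\sum_(t \in @qindex R)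
    coefs s t * (S t.1.1 t.1.2 * t.2)).
  by apply: eq_fsbigr => t _; rewrite mulrA.
rewrite (sum_coefs (fun t => S t.1.1 t.1.2 * t.2))//.
by apply: eq_bigr => e _; rewrite mulrA.
Qed.

End Riesz.

(** * Reduction of quaternion polynomials to the indexed monomials *)

Section NormalForm.
Variable R : realType.
Implicit Types (f g : quat R -> quat R) (s : seq (quat R * nat * nat * quat R)).
Implicit Types (a b q : quat R).

Definition normal f := exists2 s, normal_terms s & f = qterms s.

Let qterms_cat s s' q : qterms (s ++ s') q = qterms s q + qterms s' q.
Proof. exact: big_cat. Qed.

Lemma normalD f g : normal f -> normal g -> normal (fun q => f q + g q).
Proof.
move=> [s sI ->] [s' sI' ->]; exists (s ++ s').
  by move=> e; rewrite mem_cat => /orP[/sI|/sI'].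
by apply/funext => q; rewrite qterms_cat.
Qed.

Let lmul a s := [seq (a * e.1.1.1, e.1.1.2, e.1.2, e.2) | e <- s].

Let qterms_lmul a s q : qterms (lmul a s) q = a * qterms s q.
Proof.
by rewrite /qterms big_map mulr_sumr; apply: eq_bigr => e _; rewrite !mulrA.
Qed.

Let normal_lmul a s : normal_terms s -> normal_terms (lmul a s).
Proof. by move=> sI _ /mapP[e /sI eI ->]. Qed.

Lemma normalMl a f : normal f -> normal (fun q => a * f q).
Proof.
move=> [s sI ->]; exists (lmul a s); first exact: normal_lmul.
by apply/funext => q; rewrite qterms_lmul.
Qed.

Let normal1 a m n b : qindex (m, n, b) -> normal (fun q => a * qmonom m n q * b).
Proof.
move=> mnb; exists [:: (a, m, n, b)]; first by move=> e; rewrite inE => /eqP ->.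
by apply/funext => q; rewrite /qterms big_seq1.
Qed.

Let normal_lt a m n b : (m < n)%N -> normal (fun q => a * qmonom m n q * b).
Proof.
move=> mn; have n1 (r : R) u : qunits u -> normal (fun q => a * qreal r * qmonom m n q * u).
  by move=> uU; apply: normal1; left.
rewrite (_ : (fun q => _) = fun q =>
    a * qreal (x0 b) * qmonom m n q * 1 + a * qreal (x1 b) * qmonom m n q * qi R +
    a * qreal (x2 b) * qmonom m n q * qj R + a * qreal (x3 b) * qmonom m n q * qk R).
  by do 3 (apply: normalD; last by apply: n1; apply/qunitsE; rewrite !inE eqxx ?orbT);
    apply: n1; apply/qunitsE; rewrite inE eqxx.
apply/funext => q; set X := qmonom m n q.
have h (r : R) u : a * X * (qreal r * u) = a * qreal r * X * u.
  by rewrite mulrA -(mulrA a X) -(qrealC r X) mulrA.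
by rewrite -!h -!mulrDr mulr1 -quat_units.
Qed.

(** For m > n the monomial is the conjugate of [qmonom n m], which [qconj_units] rewrites; for m = n
    it is the real number |q|^(2m), so b moves to the left. *)
Let normal_monom a m n b : normal (fun q => a * qmonom m n q * b).
Proof.
have [mn|nm|mn] := ltngtP m n; first exact: normal_lt.
  rewrite (_ : (fun q => _) = fun q => qreal (- 2^-1) *
      (a * qmonom n m q * b + a * qi R * qmonom n m q * (qi R * b) +
       a * qj R * qmonom n m q * (qj R * b) + a * qk R * qmonom n m q * (qk R * b))).
    by apply: normalMl; do 3 (apply: normalD; last exact: normal_lt); exact: normal_lt.
  apply/funext => q; rewrite -(qmonom_conj n m) qconj_units.
  rewrite !mulrA -(qrealC _ a) -!mulrA; congr (_ * _).
  by rewrite !mulrA !mulrDr !mulrDl !mulrA.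
rewrite -mn (_ : (fun q => _) = fun q => a * b * qmonom m m q * 1).
  by apply: normal1; right.
apply/funext => q; rewrite -[in qmonom m m](addn0 m).
rewrite -{2 4}(addn0 m) qmonomE expr0 mulr1 mulr1 -!mulrA.
by congr (_ * _); rewrite qrealC.
Qed.

Lemma qpoly_normal f : qpoly f -> normal f.
Proof.
move=> [s ->]; elim: s => [|e s IH].
  by exists [::] => //; apply/funext => q; rewrite /qterms !big_nil.
rewrite (_ : (fun q => _) = fun q => e.1.1.1 * qmonom e.1.1.2 e.1.2 q * e.2 +
    \sum_(t <- s) t.1.1.1 * qmonom t.1.1.2 t.1.2 q * t.2).
  by apply: normalD => //; exact: normal_monom.
by apply/funext => q; rewrite big_cons.
Qed.

Lemma qpolyD f g : qpoly f -> qpoly g -> qpoly (fun q => f q + g q).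
Proof.
by move=> [s ->] [s' ->]; exists (s ++ s'); apply/funext => q; rewrite big_cat.
Qed.

Lemma qpolyM a b f : qpoly f -> qpoly (fun q => a * f q * b).
Proof.
move=> [s ->]; exists [seq (a * e.1.1.1, e.1.1.2, e.1.2, e.2 * b) | e <- s].
apply/funext => q; rewrite big_map mulr_sumr mulr_suml.
by apply: eq_bigr => e _; rewrite !mulrA.
Qed.

Lemma qpolyMl a f : qpoly f -> qpoly (fun q => a * f q).
Proof.
move=> /(qpolyM a 1) h; rewrite (_ : (fun q => _) = (fun q => a * f q * 1))//.
by apply/funext => q; rewrite mulr1.
Qed.

Lemma qpoly_monom m n : qpoly (@qmonom R m n).
Proof.
exists [:: (1, m, n, 1)]; apply/funext => q.
by rewrite big_seq1 mul1r mulr1.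
Qed.

Variable S : nat -> nat -> quat R.

Lemma rieszD f g : qpoly f -> qpoly g ->
  riesz S (fun q => f q + g q) = riesz S f + riesz S g.
Proof.
move=> /qpoly_normal[s sI ->] /qpoly_normal[s' sI' ->].
rewrite (_ : (fun q => _) = qterms (s ++ s')); last first.
  by apply/funext => q; rewrite qterms_cat.
rewrite !riesz_qterms// ?big_cat// => e.
by rewrite mem_cat => /orP[/sI|/sI'].
Qed.

(** There is no right-hand analogue: the normal form of |q|^(2m) b is b |q|^(2m), so its image is b
    [S m m], which may differ from [S m m] b. *)
Lemma rieszMl a f : qpoly f -> riesz S (fun q => a * f q) = a * riesz S f.
Proof.
move=> /qpoly_normal[s sI ->].
rewrite (_ : (fun q => _) = qterms (lmul a s)); last first.
  by apply/funext => q; rewrite qterms_lmul.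
rewrite !riesz_qterms//; last exact: normal_lmul.
by rewrite big_map mulr_sumr; apply: eq_bigr => e _; rewrite !mulrA.
Qed.

Lemma riesz_monom m n : (m <= n)%N -> riesz S (qmonom m n) = S m n.
Proof.
move=> mn; have -> : @qmonom R m n = qterms [:: (1, m, n, 1)].
  by apply/funext => q; rewrite /qterms big_seq1 mul1r mulr1.
rewrite riesz_qterms; first by rewrite big_seq1 mul1r mulr1.
move=> e; rewrite inE => /eqP ->; move: mn; rewrite leq_eqVlt.
move=> /predU1P[->|mn]; first by right.
by left; split => //; apply/qunitsE; rewrite inE eqxx.
Qed.

End NormalForm.

(** * The adapted space of axial polynomials *)

Section AxialPolynomials.
Variable R : realType.
Implicit Types (f g : quat R -> R) (F G : quat R -> quat R) (q : quat R).

Definition imag2 q : R := x1 q ^+ 2 + x2 q ^+ 2 + x3 q ^+ 2.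

(** Horner's scheme in both variables: the outer one contributes factors [x0], the inner one factors
    [imag2]. *)
Lemma realpoly_ind (P : (quat R -> R) -> Prop) :
  (forall r, P (fun=> r)) ->
  (forall f g, P f -> P g -> P (fun q => f q + g q)) ->
  (forall f, P f -> P (fun q => f q * x0 q)) ->
  (forall f, P f -> P (fun q => f q * imag2 q)) ->
  forall f, realpoly f -> P f.
Proof.
move=> Pc PD P0 Pi _ [p ->]; elim/poly_ind: p => [|p c IH].
  rewrite (_ : (fun q => _) = fun=> 0) ?Pc//.
  by apply/funext => q; rewrite !horner0.
rewrite (_ : (fun q => _) = fun q =>
    p.[(x0 q)%:P].[imag2 q] * x0 q + c.[imag2 q]).
  apply: (PD); first exact: P0.
  elim/poly_ind: c => [|c r IHc].
    rewrite (_ : (fun q => _) = fun=> 0) ?Pc//.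
    by apply/funext => q; rewrite horner0.
  rewrite (_ : (fun q => _) = fun q => c.[imag2 q] * imag2 q + r).
    by apply: (PD) => //; exact: Pi.
  by apply/funext => q; rewrite hornerD hornerM hornerX hornerC.
by apply/funext => q; rewrite !(hornerD, hornerM, hornerX, hornerC).
Qed.

Lemma realpoly_cst r : realpoly (fun _ : quat R => r).
Proof.
by exists (r%:P)%:P; apply/funext => q; rewrite !hornerC.
Qed.

Lemma realpolyD f g : realpoly f -> realpoly g -> realpoly (fun q => f q + g q).
Proof.
by move=> [p ->] [p' ->]; exists (p + p'); apply/funext => q; rewrite !hornerD.
Qed.

Lemma realpolyM f g : realpoly f -> realpoly g -> realpoly (fun q => f q * g q).
Proof.
by move=> [p ->] [p' ->]; exists (p * p'); apply/funext => q; rewrite !hornerM.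
Qed.

Lemma realpoly_x0 : realpoly (@x0 R).
Proof. by exists 'X; apply/funext => q; rewrite hornerX hornerC. Qed.

Lemma realpoly_imag2 : realpoly imag2.
Proof. by exists ('X%:P); apply/funext => q; rewrite hornerC hornerX. Qed.

Lemma coord_continuous_quat (i : 'I_4) : continuous (fun q : quat R => q ord0 i : R).
Proof. exact: (@coord_continuous R 1 4 ord0 i). Qed.

Lemma realpoly_continuous f : realpoly f -> continuous f.
Proof.
move: f; apply: (@realpoly_ind (fun f => continuous f)) => [r|f g cf cg|f cf|f cf] q.
- exact: cst_continuous.
- exact: (continuousD (cf q) (cg q)).
- exact: (continuousM (cf q) (@coord_continuous_quat (inord 0) q)).
- have c i := @coord_continuous_quat (inord i) q.
  have c2 i := continuousM (c i) (c i).
  exact: (continuousM (cf q) (continuousD (continuousD (c2 1%N) (c2 2%N)) (c2 3%N))).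
Qed.

(* The real-linear span of the monomials [(q^* )^k q^l], which commute with
   each other. *)
Definition central F := exists s : seq (R * nat * nat),
  F = fun q => \sum_(e <- s) qreal e.1.1 * qmonom e.1.2 e.2 q.

Let centralD F G : central F -> central G -> central (fun q => F q + G q).
Proof.
by move=> [s ->] [s' ->]; exists (s ++ s'); apply/funext => q; rewrite big_cat.
Qed.

Let centralZ r F : central F -> central (fun q => qreal r * F q).
Proof.
move=> [s ->]; exists [seq (r * e.1.1, e.1.2, e.2) | e <- s].
apply/funext => q; rewrite big_map mulr_sumr.
by apply: eq_bigr => e _; rewrite qrealM mulrA.
Qed.

Let centralMq F : central F -> central (fun q => F q * q).
Proof.
move=> [s ->]; exists [seq (e.1.1, e.1.2, e.2.+1) | e <- s].
apply/funext => q; rewrite big_map mulr_suml.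
by apply: eq_bigr => e _; rewrite /qmonom exprSr !mulrA.
Qed.

Let centralMqconj F : central F -> central (fun q => qconj q * F q).
Proof.
move=> [s ->]; exists [seq (e.1.1, e.1.2.+1, e.2) | e <- s].
apply/funext => q; rewrite big_map mulr_sumr.
by apply: eq_bigr => e _; rewrite /qmonom exprS !mulrA -qrealC.
Qed.

(** Twice x0 is q plus its conjugate. *)
Let centralM0 f : central (fun q => qreal (f q)) ->
  central (fun q => qreal (f q * x0 q)).
Proof.
move=> cf; rewrite (_ : (fun q => _) = fun q =>
    qreal 2^-1 * (qreal (f q) * q + qconj q * qreal (f q))).
  by apply: centralZ; apply: centralD; [exact: centralMq | exact: centralMqconj].
apply/funext => q; rewrite -(qrealC _ (qconj q)) -mulrDr.
by apply: quatP; rewrite !quat_realM /qconj !quatE; field.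
Qed.

Lemma realpoly_central f : realpoly f -> central (fun q => qreal (f q)).
Proof.
move: f; apply: (@realpoly_ind (fun f => central (fun q => qreal (f q)))) =>
  [r|f g cf cg|f cf|f cf].
- exists [:: (r, 0%N, 0%N)]; apply/funext => q.
  by rewrite big_seq1 /qmonom !expr0 !mulr1.
- rewrite (_ : (fun q => _) = fun q => qreal (f q) + qreal (g q)).
    exact: centralD.
  by apply/funext => q; rewrite qrealD.
- exact: centralM0.
(* Here [imag2] is |q|^2 - x0^2, with |q|^2 the product of q and its conjugate. *)
- rewrite (_ : (fun q => _) = fun q => qconj q * (qreal (f q) * q) +
      qreal (- 1) * qreal (f q * x0 q * x0 q)).
    apply: centralD; first by apply: centralMqconj; exact: centralMq.
    by apply: centralZ; exact/centralM0/centralM0.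
  apply/funext => q; rewrite mulrA -(qrealC _ (qconj q)) -mulrA qconj_mul -!qrealM -qrealD.
  by congr qreal; rewrite /imag2 /qnorm2; ring.
Qed.

Let central_qpoly F a b : central F -> qpoly (fun q => a * F q * b).
Proof.
move=> [s ->]; exists [seq (a * qreal e.1.1, e.1.2, e.2, b) | e <- s].
apply/funext => q; rewrite big_map mulr_sumr mulr_suml.
by apply: eq_bigr => e _; rewrite !mulrA.
Qed.

Definition axial f := exists f0 f1 f2 f3, [/\ realpoly f0, realpoly f1, realpoly f2,
  realpoly f3 & f = fun q => f0 q + x1 q * f1 q + x2 q * f2 q + x3 q * f3 q].

(** The identity assumed holds for x1, x2, x3 with u = i, j, k. The unit stands on different sides
    of q and of its conjugate, so two-sided coefficients are used. *)
Let qpoly_xu (x : quat R -> R) (u : quat R) f :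
  (forall q, qconj q * u + - u * q = qreal (2 * x q)) ->
  realpoly f -> qpoly (fun q => qreal (x q * f q)).
Proof.
move=> xE /realpoly_central cf.
rewrite (_ : (fun q => _) = fun q => qreal 2^-1 *
    (1 * (qconj q * qreal (f q)) * u + - u * (qreal (f q) * q) * 1)).
  by apply: qpolyMl; apply: qpolyD; apply: central_qpoly;
    [exact: centralMqconj | exact: centralMq].
apply/funext => q; rewrite mul1r mulr1 -(qrealC _ (qconj q)) !mulrA -(qrealC _ (- u)).
by rewrite -!mulrA -mulrDr xE -!qrealM; congr qreal; field.
Qed.

Lemma axial_qpoly f : axial f -> qpoly (fun q => qreal (f q)).
Proof.
move=> [f0 [f1 [f2 [f3 [/realpoly_central c0 rf1 rf2 rf3 ->]]]]].
rewrite (_ : (fun q => _) = fun q => 1 * qreal (f0 q) * 1 + qreal (x1 q * f1 q) +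
    qreal (x2 q * f2 q) + qreal (x3 q * f3 q)); last first.
  by apply/funext => q; rewrite !qrealD mul1r mulr1.
apply: qpolyD; [apply: qpolyD; [apply: qpolyD|]|].
- exact: central_qpoly.
- apply: (@qpoly_xu _ (qi R)) => // q.
  by apply: quatP; rewrite !quat_unitM /qconj !quatE; field.
- apply: (@qpoly_xu _ (qj R)) => // q.
  by apply: quatP; rewrite !quat_unitM /qconj !quatE; field.
- apply: (@qpoly_xu _ (qk R)) => // q.
  by apply: quatP; rewrite !quat_unitM /qconj !quatE; field.
Qed.

Lemma axialD f g : axial f -> axial g -> axial (fun q => f q + g q).
Proof.
move=> [f0 [f1 [f2 [f3 [r0 r1 r2 r3 ->]]]]] [g0 [g1 [g2 [g3 [s0 s1 s2 s3 ->]]]]].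
exists (fun q => f0 q + g0 q), (fun q => f1 q + g1 q), (fun q => f2 q + g2 q),
  (fun q => f3 q + g3 q).
by split; [exact: realpolyD..|apply/funext => q; ring].
Qed.

Lemma axialZ (a : R) f : axial f -> axial (fun q => a * f q).
Proof.
move=> [f0 [f1 [f2 [f3 [r0 r1 r2 r3 ->]]]]].
exists (fun q => a * f0 q), (fun q => a * f1 q), (fun q => a * f2 q), (fun q => a * f3 q).
by split; [exact: realpolyM (realpoly_cst a) _..|apply/funext => q; ring].
Qed.

Let z := realpoly_cst 0.

Lemma axial_realpoly f : realpoly f -> axial f.
Proof.
move=> rf; exists f, (fun=> 0), (fun=> 0), (fun=> 0).
by split; [exact: rf|exact: z..|apply/funext => q; rewrite !mulr0 !addr0].
Qed.

Lemma axial_imag f : realpoly f ->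
  [/\ axial (fun q => x1 q * f q), axial (fun q => x2 q * f q) &
      axial (fun q => x3 q * f q)].
Proof.
move=> rf; split.
- exists (fun=> 0), f, (fun=> 0), (fun=> 0).
  by split; [exact: z|exact: rf|exact: z..|apply/funext => q; ring].
- exists (fun=> 0), (fun=> 0), f, (fun=> 0).
  by split; [exact: z..|exact: rf|exact: z|apply/funext => q; ring].
- exists (fun=> 0), (fun=> 0), (fun=> 0), f.
  by split; [exact: z..|exact: rf|apply/funext => q; ring].
Qed.

Lemma axial_continuous f : axial f -> continuous f.
Proof.
move=> [f0 [f1 [f2 [f3 [r0 r1 r2 r3 ->]]]]] q.
have c i f' : realpoly f' ->
    continuous_at q (fun q : quat R => q ord0 (inord i) * f' q : R).
  move=> rf; exact: (continuousM (@coord_continuous_quat (inord i) q)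
    (@realpoly_continuous _ rf q)).
exact: (continuousD (continuousD (continuousD (@realpoly_continuous _ r0 q)
  (c 1%N _ r1)) (c 2%N _ r2)) (c 3%N _ r3)).
Qed.

(* [|y| <= e y ^+ 2 + (4 e)^-1], summed over [y = f0, x1 f1, x2 f2, x3 f3]; the
   squares of the last three are dominated by [imag2 q * fi q ^+ 2]. *)
Lemma axial_dominated f : axial f -> exists2 g, axial g &
  forall e, 0 < e -> exists C, forall q, `|f q| <= e * g q + C.
Proof.
move=> [f0 [f1 [f2 [f3 [r0 r1 r2 r3 ->]]]]].
pose g q := f0 q * f0 q + imag2 q * (f1 q * f1 q + f2 q * f2 q + f3 q * f3 q).
exists g.
  apply: axial_realpoly; apply: realpolyD; first exact: realpolyM.
  apply: realpolyM; first exact: realpoly_imag2.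
  by apply: realpolyD; [apply: realpolyD|]; exact: realpolyM.
move=> e e0; exists (4 * (4 * e)^-1) => q.
have amgm (y : R) : `|y| <= e * (y * y) + (4 * e)^-1.
  rewrite -subr_ge0 (_ : _ - _ = e * (`|y| - (2 * e)^-1) ^+ 2).
    by rewrite mulr_ge0 ?sqr_ge0// ltW.
  rewrite -[y * y]/(y ^+ 2) -real_normK ?num_real//.
  by field; rewrite gt_eqF.
have sq (x y : R) : x ^+ 2 <= imag2 q -> e * (x * y * (x * y)) <= e * (imag2 q * (y * y)).
  move=> xq; rewrite ler_pM2l// mulrACA ler_wpM2r// -?expr2//.
  exact: sqr_ge0.
have s1 := sq (x1 q) (f1 q); have s2 := sq (x2 q) (f2 q); have s3 := sq (x3 q) (f3 q).
have h1 := sqr_ge0 (x1 q); have h2 := sqr_ge0 (x2 q); have h3 := sqr_ge0 (x3 q).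
have {}s1 := s1 ltac:(rewrite /imag2; lra).
have {}s2 := s2 ltac:(rewrite /imag2; lra).
have {}s3 := s3 ltac:(rewrite /imag2; lra).
apply: le_trans (ler_normD _ _) _.
apply: le_trans (lerD (le_trans (ler_normD _ _) (lerD (ler_normD _ _) (lexx _))) (lexx _)) _.
have a0 := amgm (f0 q); have a1 := amgm (x1 q * f1 q).
have a2 := amgm (x2 q * f2 q); have a3 := amgm (x3 q * f3 q).
rewrite /g; lra.
Qed.

(** Functions f + g Im q with real axially symmetric f and g. They are closed under products since
    the square of Im q is - [imag2]. *)
Let axial_form F := exists f g, [/\ realpoly f, realpoly g &
  forall q, F q = mkquat (f q) (x1 q * g q) (x2 q * g q) (x3 q * g q)].

Let axial_formM F G : axial_form F -> axial_form G -> axial_form (fun q => F q * G q).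
Proof.
move=> [f [g [rf rg FE]]] [f' [g' [rf' rg' GE]]].
exists (fun q => f q * f' q + -1 * (imag2 q * (g q * g' q))),
  (fun q => f q * g' q + f' q * g q).
split; last by move=> q; rewrite FE GE /imag2; apply: quatP; rewrite !quatE; ring.
  apply: realpolyD; first exact: realpolyM.
  apply: (realpolyM (realpoly_cst _)); apply: realpolyM; first exact: realpoly_imag2.
  exact: realpolyM.
by apply: realpolyD; exact: realpolyM.
Qed.

Let axial_formX F n : axial_form F -> axial_form (fun q => F q ^+ n).
Proof.
move=> aF; elim: n => [|n IH].
  exists (fun=> 1), (fun=> 0); split; [exact: realpoly_cst..|move=> q].
  by rewrite expr0; apply: quatP; rewrite !quatE ?mulr0.
rewrite (_ : (fun q => _) = fun q => F q * F q ^+ n); first exact: axial_formM.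
by apply/funext => q; rewrite exprS.
Qed.

Lemma qmonom_axial m n :
  [/\ axial (fun q => x0 (qmonom m n q)), axial (fun q => x1 (qmonom m n q)),
      axial (fun q => x2 (qmonom m n q)) & axial (fun q => x3 (qmonom m n q))].
Proof.
have [f [g [rf rg E]]] : axial_form (@qmonom R m n).
  apply: axial_formM; apply: axial_formX.
    exists (@x0 R), (fun=> -1); split; [exact: realpoly_x0|exact: realpoly_cst|].
    by move=> q; rewrite /qconj !mulrN1.
  exists (@x0 R), (fun=> 1); split; [exact: realpoly_x0|exact: realpoly_cst|].
  by move=> q; rewrite !mulr1 mkquat_eta.
have [a1 a2 a3] := axial_imag rg.
split.
- rewrite (_ : (fun q => _) = f); first exact: axial_realpoly.
  by apply/funext => q; rewrite E mkquatE.
- by rewrite (_ : (fun q => _) = fun q => x1 q * g q)//; apply/funext => q; rewrite E mkquatE.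
- by rewrite (_ : (fun q => _) = fun q => x2 q * g q)//; apply/funext => q; rewrite E mkquatE.
- by rewrite (_ : (fun q => _) = fun q => x3 q * g q)//; apply/funext => q; rewrite E mkquatE.
Qed.

Lemma axial_sqr : axial (fun q => \sum_i q ord0 i ^+ 2).
Proof.
rewrite (_ : (fun q => _) = fun q => x0 q * x0 q + imag2 q).
  apply: axial_realpoly; apply: realpolyD; last exact: realpoly_imag2.
  by apply: realpolyM; exact: realpoly_x0.
apply/funext => q; rewrite !big_ord_recl big_ord0 addr0 /imag2 /x0 /x1 /x2 /x3 -expr2 !addrA.
by do !congr (_ + _); congr (q _ _ ^+ 2); apply/val_inj; rewrite /= inordK.
Qed.

End AxialPolynomials.

(** * Moments *)

Section MomentMeasures.
Variables (R : realType) (K : set (quat R)).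
Hypothesis K_closed : closed K.

Let open_borel (U : set (quat R)) : open U -> measurable (U : set (borel_quat R)).
Proof. by move=> oU; exact: sub_sigma_algebra. Qed.

Let mK : measurable (K : set (borel_quat R)).
Proof.
by rewrite -[K]setCK; apply: measurableC; apply: open_borel; exact: closed_openC.
Qed.

Let mKC : measurable (~` K : set (borel_quat R)).
Proof. exact: measurableC. Qed.

Variable mu : {measure set (borel_quat R) -> \bar R}.

(** Each point off the support has an open null neighbourhood, and finitely many of these cover
    C. *)
Let null_compact (C : set (quat R)) : compact C ->
  C `<=` ~` measure_support mu -> mu.-negligible (C : set (borel_quat R)).
Proof.
rewrite compact_cover => cC Cs.
have /choice[U UP] : forall q, exists U : set (quat R),
    open U /\ (C q -> U q /\ mu U = 0%E).
  move=> q; have [/Cs/existsNP[U /not_implyP[oU /not_implyP[Uq /negP mU]]]|nC] :=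
    pselect (C q); last by exists setT; split => //; exact: openT.
  exists U; split => // _; split => //; apply/eqP.
  by rewrite eq_le measure_ge0 andbT leNgt.
have [|q Cq|D DC CD] := cC _ C U; first by move=> q _; have [] := UP q.
  by exists q => //; have [_ /(_ Cq)[]] := UP q.
apply: (@negligibleS _ (borel_quat R) R mu _ _ CD); rewrite /cover bigcup_fset.
rewrite big_seq; elim/big_ind : _ => [|A B|q qD].
- exact: negligible_set0.
- exact: negligibleU.
- have [oU /(_ (set_mem (DC q qD)))[_ U0]] := UP q.
  by apply/negligibleP => //; exact: open_borel.
Qed.

(** Inner regularity reduces the complement of K to its compact subsets, which are null. *)
Lemma support_null : radon mu -> measure_support mu `<=` K -> mu (~` K) = 0%E.
Proof.
move=> [_ reg] sK; rewrite reg//; apply/eqP; rewrite eq_le; apply/andP; split.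
  apply: ge_ereal_sup => _ [C [cC CK] <-].
  have [A [mA A0 CA]] := null_compact cC (fun q Cq sq => CK q Cq (sK q sq)).
  rewrite -A0; apply: le_measure; rewrite ?inE//.
  rewrite -[C]setCK; apply: measurableC; apply: open_borel; apply: closed_openC.
  by apply: compact_closed cC; exact: norm_hausdorff.
apply: ereal_sup_ubound; exists set0; last exact: measure0.
by split; [exact: compact0|exact: sub0set].
Qed.

Lemma null_support : mu (~` K) = 0%E -> measure_support mu `<=` K.
Proof.
move=> mu0 q sq; apply: contrapT => nK.
by have := sq _ (closed_openC K_closed) nK; rewrite mu0 ltxx.
Qed.

Lemma finite_radon : (mu setT < +oo)%E ->
  (forall A : set (borel_quat R), measurable A ->
    mu A = ereal_sup [set mu C | C in [set C : set (quat R) | compact C /\ C `<=` A]]) ->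
  radon mu.
Proof.
move=> fin reg; split => // C cC; apply: le_lt_trans fin.
apply: le_measure; rewrite ?inE//.
rewrite -[C]setCK; apply: measurableC; apply: open_borel; apply: closed_openC.
by apply: compact_closed cC; exact: norm_hausdorff.
Qed.

Section Null.
Hypothesis mu0 : mu (~` K) = 0%E.

Let setTDK : setT `\` ~` K = K.
Proof. by rewrite setTD setCK. Qed.

Let Rintegral_null (f : quat R -> R) :
  mu.-integrable setT (fun q => (f q)%:E : \bar R) ->
  Rintegral mu setT f = Rintegral mu K f.
Proof.
move=> fi; rewrite /Rintegral -[in RHS]setTDK.
by rewrite (negligible_integral mKC measurableT fi mu0).
Qed.

Lemma qintegral_null F : qintegrable mu setT F ->
  qintegrable mu K F /\ qintegral mu setT F = qintegral mu K F.
Proof.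
move=> [i0 i1 i2 i3]; split; last by rewrite /qintegral !Rintegral_null.
by split; apply: (integrableS measurableT mK) => //; exact: subsetT.
Qed.

(** Integrability on K says nothing about measurability off K; continuity supplies it. *)
Let integrable_null (f : quat R -> R) : continuous f ->
  mu.-integrable K (fun q => (f q)%:E : \bar R) ->
  mu.-integrable setT (fun q => (f q)%:E : \bar R).
Proof.
move=> cf fi; apply/(negligible_integrable mKC) => //; last by rewrite setTDK.
by apply/measurable_EFinP; exact: (@continuous_borel R 4).
Qed.

Lemma qmonom_integrable_null m n : qintegrable mu K (qmonom m n) ->
  qintegrable mu setT (qmonom m n).
Proof.
have [a0 a1 a2 a3] := qmonom_axial R m n.
move=> [i0 i1 i2 i3]; split; apply: integrable_null => //; exact: axial_continuous.
Qed.
End Null.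

Section Linearity.
Implicit Types (F G : quat R -> quat R).

(** Left and right multiplication by a quaternion act on coordinates as real 4 by 4 matrices; this
    is one row. *)
Let lin4 (D : set (borel_quat R)) (mD : measurable D)
    (f0 f1 f2 f3 : quat R -> R) (c0 c1 c2 c3 : R) :
  mu.-integrable D (fun q => (f0 q)%:E : \bar R) ->
  mu.-integrable D (fun q => (f1 q)%:E : \bar R) ->
  mu.-integrable D (fun q => (f2 q)%:E : \bar R) ->
  mu.-integrable D (fun q => (f3 q)%:E : \bar R) ->
  mu.-integrable D (fun q => (c0 * f0 q + c1 * f1 q + c2 * f2 q + c3 * f3 q)%:E : \bar R) /\
  Rintegral mu D (fun q => c0 * f0 q + c1 * f1 q + c2 * f2 q + c3 * f3 q) =
  c0 * Rintegral mu D f0 + c1 * Rintegral mu D f1 + c2 * Rintegral mu D f2 +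
  c3 * Rintegral mu D f3.
Proof.
move=> i0 i1 i2 i3.
have Z c f : mu.-integrable D (fun q => (f q)%:E : \bar R) ->
    mu.-integrable D (fun q => (c * f q)%:E : \bar R).
  by move=> /(integrableZl mD c).
have DD f g : mu.-integrable D (fun q => (f q)%:E : \bar R) ->
    mu.-integrable D (fun q => (g q)%:E : \bar R) ->
    mu.-integrable D (fun q => (f q + g q)%:E : \bar R).
  by move=> fi gi; exact: (integrableD mD fi gi).
have j0 := Z c0 _ i0; have j1 := Z c1 _ i1; have j2 := Z c2 _ i2; have j3 := Z c3 _ i3.
split; first exact: (DD _ _ (DD _ _ (DD _ _ j0 j1) j2) j3).
rewrite (RintegralD mD (DD _ _ (DD _ _ j0 j1) j2) j3) (RintegralD mD (DD _ _ j0 j1) j2).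
by rewrite (RintegralD mD j0 j1) !RintegralZl.
Qed.

Let lin4E (D : set (borel_quat R)) (mD : measurable D) F (g : quat R -> R)
    (c0 c1 c2 c3 : R) : qintegrable mu D F ->
  (forall q, g q = c0 * x0 (F q) + c1 * x1 (F q) + c2 * x2 (F q) + c3 * x3 (F q)) ->
  mu.-integrable D (fun q => (g q)%:E : \bar R) /\
  Rintegral mu D g = c0 * x0 (qintegral mu D F) + c1 * x1 (qintegral mu D F) +
    c2 * x2 (qintegral mu D F) + c3 * x3 (qintegral mu D F).
Proof.
move=> [i0 i1 i2 i3] gE; rewrite !mkquatE.
have [hi hE] := lin4 mD c0 c1 c2 c3 i0 i1 i2 i3.
have -> : g = fun q => c0 * x0 (F q) + c1 * x1 (F q) + c2 * x2 (F q) + c3 * x3 (F q).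
  exact/funext.
by [].
Qed.

Lemma qintegralMl (D : set (borel_quat R)) a F : measurable D -> qintegrable mu D F ->
  qintegrable mu D (fun q => a * F q) /\
  qintegral mu D (fun q => a * F q) = a * qintegral mu D F.
Proof.
move=> mD iF.
have [i0 E0] := @lin4E D mD F (fun q => x0 (a * F q)) (x0 a) (- x1 a) (- x2 a) (- x3 a)
  iF ltac:(by move=> q /=; rewrite quatM; ring).
have [i1 E1] := @lin4E D mD F (fun q => x1 (a * F q)) (x1 a) (x0 a) (- x3 a) (x2 a)
  iF ltac:(by move=> q /=; rewrite quatM; ring).
have [i2 E2] := @lin4E D mD F (fun q => x2 (a * F q)) (x2 a) (x3 a) (x0 a) (- x1 a)
  iF ltac:(by move=> q /=; rewrite quatM; ring).
have [i3 E3] := @lin4E D mD F (fun q => x3 (a * F q)) (x3 a) (- x2 a) (x1 a) (x0 a)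
  iF ltac:(by move=> q /=; rewrite quatM; ring).
split; first by split.
by rewrite {1}/qintegral E0 E1 E2 E3; apply: quatP; rewrite quatM mkquatE; ring.
Qed.

Lemma qintegralMr (D : set (borel_quat R)) a F : measurable D -> qintegrable mu D F ->
  qintegrable mu D (fun q => F q * a) /\
  qintegral mu D (fun q => F q * a) = qintegral mu D F * a.
Proof.
move=> mD iF.
have [i0 E0] := @lin4E D mD F (fun q => x0 (F q * a)) (x0 a) (- x1 a) (- x2 a) (- x3 a)
  iF ltac:(by move=> q /=; rewrite quatM; ring).
have [i1 E1] := @lin4E D mD F (fun q => x1 (F q * a)) (x1 a) (x0 a) (x3 a) (- x2 a)
  iF ltac:(by move=> q /=; rewrite quatM; ring).
have [i2 E2] := @lin4E D mD F (fun q => x2 (F q * a)) (x2 a) (- x3 a) (x0 a) (x1 a)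
  iF ltac:(by move=> q /=; rewrite quatM; ring).
have [i3 E3] := @lin4E D mD F (fun q => x3 (F q * a)) (x3 a) (x2 a) (- x1 a) (x0 a)
  iF ltac:(by move=> q /=; rewrite quatM; ring).
split; first by split.
by rewrite {1}/qintegral E0 E1 E2 E3; apply: quatP; rewrite quatM mkquatE; ring.
Qed.

Lemma qintegralD (D : set (borel_quat R)) F G : measurable D ->
  qintegrable mu D F -> qintegrable mu D G ->
  qintegrable mu D (fun q => F q + G q) /\
  qintegral mu D (fun q => F q + G q) = qintegral mu D F + qintegral mu D G.
Proof.
move=> mD [i0 i1 i2 i3] [j0 j1 j2 j3].
have DD (f g : quat R -> R) : mu.-integrable D (fun q => (f q)%:E : \bar R) ->
    mu.-integrable D (fun q => (g q)%:E : \bar R) ->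
    mu.-integrable D (fun q => (f q + g q)%:E : \bar R).
  by move=> fi gi; exact: (integrableD mD fi gi).
split.
  split.
  - rewrite (_ : (fun q => _) = fun q => (x0 (F q) + x0 (G q))%:E); first exact: DD.
    by apply/funext => q; rewrite quatD.
  - rewrite (_ : (fun q => _) = fun q => (x1 (F q) + x1 (G q))%:E); first exact: DD.
    by apply/funext => q; rewrite quatD.
  - rewrite (_ : (fun q => _) = fun q => (x2 (F q) + x2 (G q))%:E); first exact: DD.
    by apply/funext => q; rewrite quatD.
  - rewrite (_ : (fun q => _) = fun q => (x3 (F q) + x3 (G q))%:E); first exact: DD.
    by apply/funext => q; rewrite quatD.
have E (x : quat R -> R) : (forall p p', x (p + p') = x p + x p') ->
    mu.-integrable D (fun q => (x (F q))%:E : \bar R) ->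
    mu.-integrable D (fun q => (x (G q))%:E : \bar R) ->
    Rintegral mu D (fun q => x (F q + G q)) =
    Rintegral mu D (fun q => x (F q)) + Rintegral mu D (fun q => x (G q)).
  by move=> xD xF xG; rewrite -RintegralD//; apply: eq_Rintegral => q _; exact: xD.
by apply: quatP; rewrite quatD /qintegral !mkquatE E// => p p'; rewrite quatD.
Qed.

Lemma riesz_qintegral (D : set (borel_quat R)) S f : measurable D ->
  (forall m n, (m <= n)%N -> qintegrable mu D (qmonom m n) /\
    S m n = qintegral mu D (qmonom m n)) ->
  qpoly f -> qintegrable mu D f /\ riesz S f = qintegral mu D f.
Proof.
move=> mD mom /qpoly_normal[s sI ->]; rewrite riesz_qterms//.
elim: s sI => [|e0 s IH] sI.
  have iz : qintegrable mu D (fun=> 0).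
    by split; rewrite (_ : (fun q => _) = cst 0%E) ?quat0//; exact: integrable0.
  rewrite (_ : qterms [::] = fun=> 0); last first.
    by apply/funext => q; rewrite /qterms big_nil.
  split => //; rewrite big_nil; have [_ E] := qintegralMl 0 mD iz.
  rewrite -[LHS](mul0r (qintegral mu D (fun=> 0))) -E; congr qintegral.
  by apply/funext => q; rewrite mul0r.
have [is_ Es] := IH (fun e es => sI e (mem_behead (s := e0 :: s) es)).
have mn : (e0.1.1.2 <= e0.1.2)%N.
  by have [[/ltnW]|[/= ->]] := sI e0 (mem_head _ _).
have [im Em] := mom _ _ mn.
have [ia Ea] := qintegralMl e0.1.1.1 mD im.
have [ib Eb] := qintegralMr e0.2 mD ia.
have [ic Ec] := qintegralD mD ib is_.
rewrite (_ : qterms _ = fun q => e0.1.1.1 * qmonom e0.1.1.2 e0.1.2 q * e0.2 + qterms s q).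
  by split => //; rewrite big_cons Em Es Ec Eb Ea.
by apply/funext => q; rewrite /qterms big_cons.
Qed.

End Linearity.
End MomentMeasures.

(** * The implications between (i), (ii) and (iii) *)

Section Equivalences.
Variables (R : realType) (K : set (quat R)) (S : nat -> nat -> quat R).
Hypothesis K_closed : closed K.

Let mK : measurable (K : set (borel_quat R)).
Proof.
rewrite -[K]setCK; apply: measurableC; apply: sub_sigma_algebra.
exact: closed_openC.
Qed.

(** Two-sided linearity is inherited from the integral. *)
Lemma moment_sequence_functional :
  moment_sequence K S -> moment_functional K (riesz S).
Proof.
move=> [mu [rmu sK mom]]; have mu0 := support_null K_closed rmu sK.
have rep f : qpoly f -> qintegrable mu K f /\ riesz S f = qintegral mu K f.
  apply: riesz_qintegral => // m n mn; have [im ->] := mom m n mn.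
  exact: qintegral_null.
split; last by exists mu.
move=> f g pf pg a b c d.
have [if_ Ef] := rep _ pf; have [ig Eg] := rep _ pg.
have [ia Ea] := qintegralMl a mK if_; have [ib Eb] := qintegralMr b mK ia.
have [ic Ec] := qintegralMl c mK ig; have [id Ed] := qintegralMr d mK ic.
have [_ ->] := rep _ (qpolyD (qpolyM a b pf) (qpolyM c d pg)).
by have [_ ->] := qintegralD mK ib id; rewrite Eb Ea Ed Ec Ef Eg.
Qed.

Lemma moment_functional_sequence :
  moment_functional K (riesz S) -> moment_sequence K S.
Proof.
move=> [_ [mu [rmu mu0 rep]]]; exists mu; split => //; first exact: null_support.
move=> m n mn; have [iK E] := rep _ (qpoly_monom R m n).
have iT := qmonom_integrable_null K_closed mu0 iK; split => //.
by rewrite -riesz_monom// E; have [_ ->] := qintegral_null K_closed mu0 iT.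
Qed.

Lemma moment_functional_ge0 f : moment_functional K (riesz S) -> axial f ->
  (forall q, K q -> 0 <= f q) -> qnonneg (riesz S (fun q => qreal (f q))).
Proof.
move=> [_ [mu [rmu mu0 rep]]] af f0.
have [_ ->] := rep _ (axial_qpoly af).
exists (Rintegral mu K f); first exact: Rintegral_ge0.
have z (x : quat R -> R) : (forall r, x (qreal r) = 0) ->
    Rintegral mu K (fun q => x (qreal (f q))) = 0.
  move=> x0; under eq_Rintegral do rewrite x0.
  by rewrite Rintegral_cst// mul0r.
rewrite /qintegral (z (@x1 R)) ?(z (@x2 R)) ?(z (@x3 R)); try by move=> r; rewrite mkquatE.
apply: quatP; rewrite !mkquatE//; apply: eq_Rintegral => q _.
by rewrite mkquatE.
Qed.

Lemma nonneg_moment_sequence :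
  (forall f, axial f -> (forall q, K q -> 0 <= f q) ->
    qnonneg (riesz S (fun q => qreal (f q)))) -> moment_sequence K S.
Proof.
move=> pos; pose L f := x0 (riesz S (fun q => qreal (f q))).
have rD f g : axial f -> axial g -> riesz S (fun q => qreal (f q + g q)) =
    riesz S (fun q => qreal (f q)) + riesz S (fun q => qreal (g q)).
  move=> /axial_qpoly af /axial_qpoly ag; rewrite -rieszD//.
  by congr riesz; apply/funext => q; rewrite qrealD.
have rZ (a : R) f : axial f -> riesz S (fun q => qreal (a * f q)) =
    qreal a * riesz S (fun q => qreal (f q)).
  move=> /axial_qpoly af; rewrite -rieszMl//.
  by congr riesz; apply/funext => q; rewrite qrealM.
(* For a majorant h of |f|, both h and h + f are nonnegative, so the value at f is a difference of
   two real numbers. *)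
have real f : axial f -> riesz S (fun q => qreal (f q)) = qreal (L f).
  move=> af; have [g ag fg] := axial_dominated af.
  have [C {}fg] := fg _ ltr01; pose h q : R := 1 * g q + C * 1.
  have ah : axial h.
    by apply: axialD; apply: axialZ => //; exact/axial_realpoly/realpoly_cst.
  have fh q : `|f q| <= h q by rewrite /h [C * 1]mulr1; exact: fg.
  have [r _ hr] := pos _ ah (fun q _ => le_trans (normr_ge0 _) (fh q)).
  have [r' _ hr'] := pos _ (axialD ah af) (fun q _ => ltac:(
    by move: (fh q); rewrite ler_norml => /andP[]; lra)).
  rewrite /L; move: hr'; rewrite rD// hr => /(congr1 (fun p => - qreal r + p)).
  by rewrite addKr -qrealN -qrealD => ->; rewrite mkquatE.
have [mu [fin reg mu0 rep]] : exists mu : {measure set (borel_quat R) -> \bar R},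
  [/\ (mu setT < +oo)%E,
   (forall A : set (borel_quat R), measurable A -> mu A =
     ereal_sup [set mu C | C in [set C : set (quat R) | compact C /\ C `<=` A]]),
   mu (~` K) = 0%E &
   forall f, axial f -> mu.-integrable K (fun q => (f q)%:E) /\
     Rintegral mu K f = L f].
  apply: (@adapted_haviland R 4 K (@axial R) L K_closed).
  - exact: axialD.
  - exact: axialZ.
  - by move=> f g af ag; rewrite /L rD// quatD.
  - by move=> a f af; rewrite /L rZ// quat_realM mkquatE.
  - by move=> f af f0; have [r r0 rE] := pos f af f0; rewrite /L rE mkquatE.
  - exact: axial_continuous.
  - exact/axial_realpoly/realpoly_cst.
  - exact: axial_sqr.
  - move=> f af; have [g ag fg] := axial_dominated af; exists g => // e e0.
    by have [C fC] := fg e e0; exists C => q _.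
exists mu; split; [exact: finite_radon|exact: null_support|move=> m n mn].
have [a0 a1 a2 a3] := qmonom_axial R m n.
have [[i0 E0] [i1 E1]] := (rep _ a0, rep _ a1).
have [[i2 E2] [i3 E3]] := (rep _ a2, rep _ a3).
have iT : qintegrable mu setT (qmonom m n) by apply: (qmonom_integrable_null K_closed mu0).
split => //; have [_ ->] := qintegral_null K_closed mu0 iT.
rewrite /qintegral E0 E1 E2 E3.
have q0 := axial_qpoly a0; have q1 := axial_qpoly a1.
have q2 := axial_qpoly a2; have q3 := axial_qpoly a3.
(* The components are recombined with the units on the left, the side on which [riesz] is
   homogeneous. *)
have -> : S m n = riesz S (fun q => qreal (x0 (qmonom m n q)) +
    qi R * qreal (x1 (qmonom m n q)) + qj R * qreal (x2 (qmonom m n q)) +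
    qk R * qreal (x3 (qmonom m n q))).
  rewrite -(riesz_monom S mn); congr riesz.
  by apply/funext => q; rewrite -!qrealC -quat_units.
have p1 := qpolyMl (qi R) q1; have p2 := qpolyMl (qj R) q2; have p3 := qpolyMl (qk R) q3.
rewrite (rieszD _ (qpolyD (qpolyD q0 p1) p2) p3) (rieszD _ (qpolyD q0 p1) p2).
rewrite (rieszD _ q0 p1) !rieszMl// !real// -!qrealC.
by apply: quatP; rewrite !(quat_realM, quatD, mkquatE); ring.
Qed.

End Equivalences.

Theorem theorem5p7 (R : realType) (K : set (quat R)) (hK : closed K)
    (S : nat -> nat -> quat R) :
  (moment_sequence K S <-> moment_functional K (riesz S)) /\
  (moment_functional K (riesz S) <->
   (forall f0 f1 f2 f3 : quat R -> R,
      realpoly f0 -> realpoly f1 -> realpoly f2 -> realpoly f3 ->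
      let f q := f0 q + x1 q * f1 q + x2 q * f2 q + x3 q * f3 q in
      (forall q, K q -> 0 <= f q) ->
      qnonneg (riesz S (fun q => qreal (f q))))).
Proof.
split; first split.
- exact: moment_sequence_functional.
- exact: moment_functional_sequence.
split => [mf f0 f1 f2 f3 r0 r1 r2 r3 f fK|pos].
  by apply: (moment_functional_ge0 hK mf) fK; exists f0, f1, f2, f3.
apply: moment_sequence_functional => //; apply: nonneg_moment_sequence => // f.
by move=> [f0 [f1 [f2 [f3 [r0 r1 r2 r3 ->]]]]]; exact: pos.
Qed.
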